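(* Let $\mathcal{C}$ be a finitely complete category, regarded as a symmetric (hence braided) monoidal category via its finite products, and let $(\mathcal{D},\otimes,\mathbf{1},\beta)$ be a braided monoidal category. Let $L\colon\mathcal{C}\to\mathcal{D}$ and $R\colon\mathcal{D}\to\mathcal{C}$ be functors such that $L$ is left adjoint to $R$, and suppose that $L$ is a braided bistrong monoidal functor. Then the induced functor $\widehat{L}\colon\mathsf{Hopf}(\mathcal{C})\to\mathsf{Hopf}(\mathcal{D})$ has a right adjoint $$\mathbb{G}\colon\mathsf{Hopf}(\mathcal{D})\longrightarrow\mathsf{Hopf}(\mathcal{C}).$$
   Context: Associators are suppressed from the notation; $\lambda,\rho$ denote left and right unitors. A finitely complete category $\mathcal{C}$ carries its cartesian monoidal structure: tensor product $\times$, unit the terminal object, braiding the swap $\tau_{X,Y}\colon X\times Y\to Y\times X$. **Hopf monoids.** Let $(\mathcal{E},\otimes,\mathbf{1},\beta)$ be a braided monoidal category. A bimonoid in $\mathcal{E}$ is $(B,m,u,d,e)$ with $(B,m,u)$ a monoid (associative multiplication $m\colon B\otimes B\to B$, two-sided unit $u\colon\mathbf{1}\to B$) and $(B,d,e)$ a comonoid (coassociative $d\colon B\to B\otimes B$, two-sided counit $e\colon B\to\mathbf{1}$), such that $d\circ m=(m\otimes m)\circ(1_B\otimes\beta_{B,B}\otimes 1_B)\circ(d\otimes d)$, $e\circ u=1_{\mathbf{1}}$, $e\circ m=\lambda_{\mathbf{1}}\circ(e\otimes e)$ and $d\circ u=(u\otimes u)\circ\lambda_{\mathbf{1}}^{-1}$.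 A morphism of bimonoids is a morphism that commutes with $m,u,d,e$. For a monoid $(M,m,u)$ and a comonoid $(C,d,e)$, the set $\mathrm{Hom}_{\mathcal{E}}(C,M)$ is a monoid under convolution $f*g=m\circ(f\otimes g)\circ d$ with unit $u\circ e$. A Hopf monoid is a bimonoid $H$ for which $1_H$ is invertible in the convolution monoid $\mathrm{Hom}_{\mathcal{E}}(H,H)$; the inverse is called the antipode. $\mathsf{Hopf}(\mathcal{E})$ is the full subcategory, on the Hopf monoids, of the category of bimonoids and bimonoid morphisms. **Monoidal functors.** Let $(\mathcal{C}_1,\otimes_1,\mathbf{1}_1,\beta_1)$ and $(\mathcal{C}_2,\otimes_2,\mathbf{1}_2,\beta_2)$ be braided monoidal categories and $F\colon\mathcal{C}_1\to\mathcal{C}_2$ a functor. A lax structure on $F$ consists of a natural transformation $\phi_{X,Y}\colon F(X)\otimes_2F(Y)\to F(X\otimes_1Y)$ and a morphism $\phi_0\colon\mathbf{1}_2\to F(\mathbf{1}_1)$ satisfying the usual associativity and left and right unit coherence axioms. A colax structure consists of a natural transformation $\psi_{X,Y}\colon F(X\otimes_1Y)\to F(X)\otimes_2F(Y)$ and a morphism $\psi_0\colon F(\mathbf{1}_1)\to\mathbf{1}_2$ satisfying the dual axioms. $F$ is bilax monoidal if it has a lax structure $(\phi,\phi_0)$ and a colax structure $(\psi,\psi_0)$ such that, for all objects $W,X,Y,Z$, $$\psi_{W\otimes_1Y,\,X\otimes_1Z}\circ F(1_W\otimes_1(\beta_1)_{X,Y}\otimes_1 1_Z)\circ\phi_{W\otimes_1X,\,Y\otimes_1Z}=(\phi_{W,Y}\otimes_2\phi_{X,Z})\circ(1_{F(W)}\otimes_2(\beta_2)_{F(X),F(Y)}\otimes_2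 1_{F(Z)})\circ(\psi_{W,X}\otimes_2\psi_{Y,Z}),$$ and $$\psi_{\mathbf{1}_1,\mathbf{1}_1}\circ F(\lambda_{1,\mathbf{1}_1}^{-1})\circ\phi_0=(\phi_0\otimes_2\phi_0)\circ\lambda_{2,\mathbf{1}_2}^{-1},\qquad \psi_0\circ F(\lambda_{1,\mathbf{1}_1})\circ\phi_{\mathbf{1}_1,\mathbf{1}_1}=\lambda_{2,\mathbf{1}_2}\circ(\psi_0\otimes_2\psi_0),\qquad \psi_0\circ\phi_0=1_{\mathbf{1}_2},$$ where $\lambda_1,\lambda_2$ denote the left unitors of $\mathcal{C}_1,\mathcal{C}_2$. $F$ is bistrong monoidal if it is bilax monoidal and $\phi,\phi_0,\psi,\psi_0$ are all isomorphisms. $F$ is braided if $\phi_{Y,X}\circ(\beta_2)_{F(X),F(Y)}=F((\beta_1)_{X,Y})\circ\phi_{X,Y}$ for all $X,Y$. **Induced functor.** A bistrong monoidal functor $F$ induces a functor $\widehat{F}\colon\mathsf{Hopf}(\mathcal{C}_1)\to\mathsf{Hopf}(\mathcal{C}_2)$ sending $(H,m,u,d,e)$ with antipode $s$ to $\bigl(F(H),\,F(m)\circ\phi_{H,H},\,F(u)\circ\phi_0,\,\psi_{H,H}\circ F(d),\,\psi_0\circ F(e)\bigr)$ with antipode $F(s)$, and sending a morphism $f$ to $F(f)$. *)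

(* Defs.v *)
From Stdlib Require Import List FinFun ProofIrrelevance.

Set Implicit Arguments.
Unset Strict Implicit.
Unset Printing Implicit Defensive.

Declare Scope cat_scope.
Delimit Scope cat_scope with cat.
Local Open Scope cat_scope.

Record Category := {
  ob :> Type;
  hom : ob -> ob -> Type;
  idm : forall X, hom X X;
  comp : forall X Y Z, hom Y Z -> hom X Y -> hom X Z;
  comp_id_l : forall X Y (f : hom X Y), comp (idm Y) f = f;
  comp_id_r : forall X Y (f : hom X Y), comp f (idm X) = f;
  comp_assoc : forall W X Y Z (h : hom Y Z) (g : hom X Y) (f : hom W X),
    comp (comp h g) f = comp h (comp g f)
}.

Arguments hom {c} X Y.
Arguments idm {c} X.
Arguments comp {c X Y Z} g f.

Notation "X ~> Y" := (hom X Y) (at level 70, no associativity) : cat_scope.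
Notation "g ∘ f" := (comp g f) (at level 40, left associativity) : cat_scope.

Definition IsIso {C : Category} {X Y : C} (f : X ~> Y) : Prop :=
  exists g : Y ~> X, g ∘ f = idm X /\ f ∘ g = idm Y.

Record Functor (C D : Category) := {
  fob :> C -> D;
  fmap : forall X Y : C, X ~> Y -> fob X ~> fob Y;
  fmap_id : forall X : C, fmap (idm X) = idm (fob X);
  fmap_comp : forall (X Y Z : C) (g : Y ~> Z) (f : X ~> Y),
    fmap (g ∘ f) = fmap g ∘ fmap f
}.

Arguments fmap {C D} F {X Y} f : rename.

(** [Adjunction L R]: [L] is left adjoint to [R]. *)
Record Adjunction (C D : Category) (L : Functor C D) (R : Functor D C) := {
  adj_to : forall (X : C) (Y : D), L X ~> Y -> X ~> R Y;
  adj_from : forall (X : C) (Y : D), X ~> R Y -> L X ~> Y;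
  adj_from_to : forall X Y (f : L X ~> Y), adj_from (adj_to f) = f;
  adj_to_from : forall X Y (g : X ~> R Y), adj_to (adj_from g) = g;
  adj_natural : forall (X X' : C) (Y Y' : D)
      (h : X' ~> X) (f : L X ~> Y) (k : Y ~> Y'),
    adj_to (k ∘ f ∘ fmap L h) = fmap R k ∘ adj_to f ∘ h
}.

Definition HasRightAdjoint (C D : Category) (L : Functor C D) : Prop :=
  exists G : Functor D C, inhabited (Adjunction L G).

Lemma sig_ext (A : Type) (P : A -> Prop) (x y : {a : A | P a}) :
  proj1_sig x = proj1_sig y -> x = y.
Proof.
  destruct x as [x p], y as [y q]; simpl; intros e; subst y.
  f_equal; apply proof_irrelevance.
Qed.

Definition FullSubcategory (C : Category) (P : C -> Prop) : Category := {|
  ob := {X : C | P X};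
  hom := fun X Y => proj1_sig X ~> proj1_sig Y;
  idm := fun X => idm (proj1_sig X);
  comp := fun X Y Z g f => g ∘ f;
  comp_id_l := fun X Y f => comp_id_l f;
  comp_id_r := fun X Y f => comp_id_r f;
  comp_assoc := fun W X Y Z h g f => comp_assoc h g f
|}.

Definition RestrictFunctor (C D : Category) (P : C -> Prop) (Q : D -> Prop)
    (F : Functor C D) (PQ : forall X : C, P X -> Q (F X)) :
    Functor (FullSubcategory P) (FullSubcategory Q) :=
  Build_Functor (C := FullSubcategory P) (D := FullSubcategory Q)
    (fob := fun X => exist Q (F (proj1_sig X)) (PQ _ (proj2_sig X)))
    (fmap := fun X Y f => fmap F f)
    (fun X => fmap_id F (proj1_sig X))
    (fun X Y Z g f => fmap_comp F g f).

Definition FiniteCategory (J : Category) : Prop :=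
  Finite J /\ forall i j : J, Finite (i ~> j).

Record Cone (J C : Category) (F : Functor J C) := {
  apex : C;
  leg : forall j : J, apex ~> F j;
  leg_natural : forall (i j : J) (a : i ~> j), fmap F a ∘ leg i = leg j
}.

Definition IsLimit (J C : Category) (F : Functor J C) (K : Cone F) : Prop :=
  forall K' : Cone F,
    exists! h : apex K' ~> apex K, forall j : J, leg K j ∘ h = leg K' j.

Definition FinitelyComplete (C : Category) : Prop :=
  forall J : Category, FiniteCategory J ->
  forall F : Functor J C, exists K : Cone F, IsLimit K.

(** A choice of terminal object and of binary products, from which the
    cartesian monoidal structure is built. *)
Record FiniteProducts (C : Category) := {
  term : C;
  bang : forall X : C, X ~> term;
  bang_uniq : forall (X : C) (f : X ~> term), f = bang X;
  prd : C -> C -> C;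
  pr1 : forall X Y : C, prd X Y ~> X;
  pr2 : forall X Y : C, prd X Y ~> Y;
  pair : forall Z X Y : C, Z ~> X -> Z ~> Y -> Z ~> prd X Y;
  pr1_pair : forall (Z X Y : C) (f : Z ~> X) (g : Z ~> Y), pr1 X Y ∘ pair f g = f;
  pr2_pair : forall (Z X Y : C) (f : Z ~> X) (g : Z ~> Y), pr2 X Y ∘ pair f g = g;
  pair_uniq : forall (Z X Y : C) (h : Z ~> prd X Y),
    h = pair (pr1 X Y ∘ h) (pr2 X Y ∘ h)
}.

Arguments bang {C} P X : rename.
Arguments pr1 {C} P X Y : rename.
Arguments pr2 {C} P X Y : rename.
Arguments pair {C} P {Z X Y} _ _ : rename.

Record MonoidalCategory := {
  mcat :> Category;
  munit : mcat;
  tens : mcat -> mcat -> mcat;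
  tensm : forall X X' Y Y' : mcat,
    X ~> X' -> Y ~> Y' -> tens X Y ~> tens X' Y';
  tensm_id : forall X Y : mcat, tensm (idm X) (idm Y) = idm (tens X Y);
  tensm_comp : forall (X X' X'' Y Y' Y'' : mcat)
      (g : X' ~> X'') (f : X ~> X') (k : Y' ~> Y'') (h : Y ~> Y'),
    tensm (g ∘ f) (k ∘ h) = tensm g k ∘ tensm f h;
  asso : forall X Y Z : mcat, tens (tens X Y) Z ~> tens X (tens Y Z);
  asso_inv : forall X Y Z : mcat, tens X (tens Y Z) ~> tens (tens X Y) Z;
  asso_inv_l : forall X Y Z, asso_inv X Y Z ∘ asso X Y Z = idm _;
  asso_inv_r : forall X Y Z, asso X Y Z ∘ asso_inv X Y Z = idm _;
  asso_natural : forall (X X' Y Y' Z Z' : mcat)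
      (f : X ~> X') (g : Y ~> Y') (h : Z ~> Z'),
    asso X' Y' Z' ∘ tensm (tensm f g) h = tensm f (tensm g h) ∘ asso X Y Z;
  lun : forall X : mcat, tens munit X ~> X;
  lun_inv : forall X : mcat, X ~> tens munit X;
  lun_inv_l : forall X, lun_inv X ∘ lun X = idm _;
  lun_inv_r : forall X, lun X ∘ lun_inv X = idm _;
  lun_natural : forall (X X' : mcat) (f : X ~> X'),
    lun X' ∘ tensm (idm munit) f = f ∘ lun X;
  run : forall X : mcat, tens X munit ~> X;
  run_inv : forall X : mcat, X ~> tens X munit;
  run_inv_l : forall X, run_inv X ∘ run X = idm _;
  run_inv_r : forall X, run X ∘ run_inv X = idm _;
  run_natural : forall (X X' : mcat) (f : X ~> X'),
    run X' ∘ tensm f (idm munit) = f ∘ run X;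
  triangle : forall X Y : mcat,
    tensm (idm X) (lun Y) ∘ asso X munit Y = tensm (run X) (idm Y);
  pentagon : forall W X Y Z : mcat,
    asso W X (tens Y Z) ∘ asso (tens W X) Y Z =
    tensm (idm W) (asso X Y Z) ∘ asso W (tens X Y) Z ∘ tensm (asso W X Y) (idm Z)
}.

Arguments munit {m}.
Arguments tens {m} X Y.
Arguments tensm {m X X' Y Y'} f g.
Arguments asso {m} X Y Z.
Arguments asso_inv {m} X Y Z.
Arguments lun {m} X.
Arguments lun_inv {m} X.
Arguments run {m} X.
Arguments run_inv {m} X.

Notation "X ⊗ Y" := (tens X Y) (at level 34, left associativity) : cat_scope.
Notation "f ⊠ g" := (tensm f g) (at level 34, left associativity) : cat_scope.

Record BraidedCategory := {
  bmon :> MonoidalCategory;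
  braid : forall X Y : bmon, X ⊗ Y ~> Y ⊗ X;
  braid_inv : forall X Y : bmon, Y ⊗ X ~> X ⊗ Y;
  braid_inv_l : forall X Y, braid_inv X Y ∘ braid X Y = idm _;
  braid_inv_r : forall X Y, braid X Y ∘ braid_inv X Y = idm _;
  braid_natural : forall (X X' Y Y' : bmon) (f : X ~> X') (g : Y ~> Y'),
    braid X' Y' ∘ (f ⊠ g) = (g ⊠ f) ∘ braid X Y;
  hexagon1 : forall X Y Z : bmon,
    asso Y Z X ∘ braid X (Y ⊗ Z) ∘ asso X Y Z =
    (idm Y ⊠ braid X Z) ∘ asso Y X Z ∘ (braid X Y ⊠ idm Z);
  hexagon2 : forall X Y Z : bmon,
    asso_inv Z X Y ∘ braid (X ⊗ Y) Z ∘ asso_inv X Y Z =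
    (braid X Z ⊠ idm Y) ∘ asso_inv X Z Y ∘ (idm X ⊠ braid Y Z)
}.

Arguments braid {b} X Y.
Arguments braid_inv {b} X Y.

(** [interchange W X Y Z] is [1_W ⊗ β_{X,Y} ⊗ 1_Z] with the associators
    written out. *)
Definition interchange {E : BraidedCategory} (W X Y Z : E) :
    (W ⊗ X) ⊗ (Y ⊗ Z) ~> (W ⊗ Y) ⊗ (X ⊗ Z) :=
  asso_inv W Y (X ⊗ Z)
  ∘ (idm W ⊠ (asso Y X Z ∘ (braid X Y ⊠ idm Z) ∘ asso_inv X Y Z))
  ∘ asso W X (Y ⊗ Z).

Lemma pair_ext (C : Category) (P : FiniteProducts C) (Z X Y : C)
    (h k : Z ~> prd P X Y) :
  pr1 P X Y ∘ h = pr1 P X Y ∘ k -> pr2 P X Y ∘ h = pr2 P X Y ∘ k -> h = k.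
Proof.
  intros e1 e2. rewrite (pair_uniq h), (pair_uniq k), e1, e2. reflexivity.
Qed.

Lemma term_ext (C : Category) (P : FiniteProducts C) (Z : C)
    (h k : Z ~> term P) : h = k.
Proof. rewrite (bang_uniq h), (bang_uniq k). reflexivity. Qed.

Lemma pr1_pair_l (C : Category) (P : FiniteProducts C) (W Z X Y : C)
    (f : Z ~> X) (g : Z ~> Y) (h : W ~> Z) :
  pr1 P X Y ∘ (pair P f g ∘ h) = f ∘ h.
Proof. rewrite <- comp_assoc, pr1_pair. reflexivity. Qed.

Lemma pr2_pair_l (C : Category) (P : FiniteProducts C) (W Z X Y : C)
    (f : Z ~> X) (g : Z ~> Y) (h : W ~> Z) :
  pr2 P X Y ∘ (pair P f g ∘ h) = g ∘ h.
Proof. rewrite <- comp_assoc, pr2_pair. reflexivity. Qed.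

Ltac cartesian :=
  intros;
  repeat rewrite ?comp_assoc, ?pr1_pair, ?pr2_pair, ?pr1_pair_l, ?pr2_pair_l,
    ?comp_id_l, ?comp_id_r;
  first [ reflexivity | apply term_ext | apply pair_ext; cartesian ].

Definition CartesianMonoidal (C : Category) (P : FiniteProducts C) :
    MonoidalCategory.
Proof.
  refine {|
    mcat := C;
    munit := term P;
    tens := prd P;
    tensm := fun X X' Y Y' f g => pair P (f ∘ pr1 P X Y) (g ∘ pr2 P X Y);
    asso := fun X Y Z =>
      pair P (pr1 P X Y ∘ pr1 P (prd P X Y) Z)
             (pair P (pr2 P X Y ∘ pr1 P (prd P X Y) Z) (pr2 P (prd P X Y) Z));
    asso_inv := fun X Y Z =>
      pair P (pair P (pr1 P X (prd P Y Z)) (pr1 P Y Z ∘ pr2 P X (prd P Y Z)))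
             (pr2 P Y Z ∘ pr2 P X (prd P Y Z));
    lun := fun X => pr2 P (term P) X;
    lun_inv := fun X => pair P (bang P X) (idm X);
    run := fun X => pr1 P X (term P);
    run_inv := fun X => pair P (idm X) (bang P X)
  |}; abstract cartesian.
Defined.

Definition CartesianBraided (C : Category) (P : FiniteProducts C) :
    BraidedCategory.
Proof.
  refine {|
    bmon := CartesianMonoidal P;
    braid := fun X Y : CartesianMonoidal P => pair P (pr2 P X Y) (pr1 P X Y);
    braid_inv := fun X Y : CartesianMonoidal P => pair P (pr2 P Y X) (pr1 P Y X)
  |}; abstract (simpl; cartesian).
Defined.

Record MonoidOn {E : MonoidalCategory} (M : E) := {
  mul : M ⊗ M ~> M;
  one : munit ~> M;
  mul_assoc : mul ∘ (mul ⊠ idm M) = mul ∘ (idm M ⊠ mul) ∘ asso M M M;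
  mul_one_l : mul ∘ (one ⊠ idm M) = lun M;
  mul_one_r : mul ∘ (idm M ⊠ one) = run M
}.

Record ComonoidOn {E : MonoidalCategory} (K : E) := {
  dup : K ~> K ⊗ K;
  del : K ~> munit;
  dup_assoc : asso K K K ∘ (dup ⊠ idm K) ∘ dup = (idm K ⊠ dup) ∘ dup;
  dup_del_l : (del ⊠ idm K) ∘ dup = lun_inv K;
  dup_del_r : (idm K ⊠ del) ∘ dup = run_inv K
}.

Definition convolution {E : MonoidalCategory} {K M : E}
    (c : ComonoidOn K) (a : MonoidOn M) (f g : K ~> M) : K ~> M :=
  mul a ∘ (f ⊠ g) ∘ dup c.

Definition convolution_unit {E : MonoidalCategory} {K M : E}
    (c : ComonoidOn K) (a : MonoidOn M) : K ~> M :=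
  one a ∘ del c.

Definition ConvolutionInverse {E : MonoidalCategory} {K M : E}
    (c : ComonoidOn K) (a : MonoidOn M) (f g : K ~> M) : Prop :=
  convolution c a f g = convolution_unit c a /\
  convolution c a g f = convolution_unit c a.

Record Bimonoid (E : BraidedCategory) := {
  bi_ob :> E;
  bi_mon : MonoidOn bi_ob;
  bi_com : ComonoidOn bi_ob;
  bi_dup_mul : dup bi_com ∘ mul bi_mon =
    (mul bi_mon ⊠ mul bi_mon) ∘ interchange bi_ob bi_ob bi_ob bi_ob
    ∘ (dup bi_com ⊠ dup bi_com);
  bi_del_one : del bi_com ∘ one bi_mon = idm munit;
  bi_del_mul : del bi_com ∘ mul bi_mon = lun munit ∘ (del bi_com ⊠ del bi_com);
  bi_dup_one : dup bi_com ∘ one bi_mon = (one bi_mon ⊠ one bi_mon) ∘ lun_inv munit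
}.

Arguments bi_mon {E} b.
Arguments bi_com {E} b.

Record IsBimonoidMorphism {E : BraidedCategory} (A B : Bimonoid E) (f : A ~> B) :
    Prop := {
  bim_mul : f ∘ mul (bi_mon A) = mul (bi_mon B) ∘ (f ⊠ f);
  bim_one : f ∘ one (bi_mon A) = one (bi_mon B);
  bim_dup : dup (bi_com B) ∘ f = (f ⊠ f) ∘ dup (bi_com A);
  bim_del : del (bi_com B) ∘ f = del (bi_com A)
}.

Lemma bimonoid_morphism_id {E : BraidedCategory} (A : Bimonoid E) :
  IsBimonoidMorphism (A := A) (B := A) (idm A).
Proof.
  split; rewrite ?tensm_id, ?comp_id_l, ?comp_id_r; reflexivity.
Qed.

Lemma bimonoid_morphism_comp {E : BraidedCategory} (A B K : Bimonoid E)
    (g : B ~> K) (f : A ~> B) :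
  IsBimonoidMorphism g -> IsBimonoidMorphism f ->
  IsBimonoidMorphism (A := A) (B := K) (g ∘ f).
Proof.
  intros [g1 g2 g3 g4] [f1 f2 f3 f4]; split.
  - rewrite comp_assoc, f1, <- comp_assoc, g1, tensm_comp, comp_assoc; reflexivity.
  - rewrite comp_assoc, f2, g2; reflexivity.
  - rewrite <- comp_assoc, g3, comp_assoc, f3, tensm_comp, comp_assoc; reflexivity.
  - rewrite <- comp_assoc, g4, f4; reflexivity.
Qed.

Definition BimonoidCategory (E : BraidedCategory) : Category.
Proof.
  refine {|
    ob := Bimonoid E;
    hom := fun A B => {f : A ~> B | IsBimonoidMorphism f};
    idm := fun A => exist _ (idm (bi_ob A)) (bimonoid_morphism_id A);
    comp := fun A B K g f =>
      exist _ (proj1_sig g ∘ proj1_sig f)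
        (bimonoid_morphism_comp (proj2_sig g) (proj2_sig f))
  |}; abstract (intros; apply sig_ext; simpl;
                first [apply comp_id_l | apply comp_id_r | apply comp_assoc]).
Defined.

Definition IsHopf {E : BraidedCategory} (H : Bimonoid E) : Prop :=
  exists s : H ~> H, ConvolutionInverse (bi_com H) (bi_mon H) (idm H) s.

Definition Hopf (E : BraidedCategory) : Category :=
  FullSubcategory (C := BimonoidCategory E) (@IsHopf E).

Record LaxStructure (C D : MonoidalCategory) (F : Functor C D) := {
  lax2 : forall X Y : C, F X ⊗ F Y ~> F (X ⊗ Y);
  lax0 : munit ~> F munit;
  lax2_natural : forall (X X' Y Y' : C) (f : X ~> X') (g : Y ~> Y'),
    lax2 X' Y' ∘ (fmap F f ⊠ fmap F g) = fmap F (f ⊠ g) ∘ lax2 X Y;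
  lax_assoc : forall X Y Z : C,
    fmap F (asso X Y Z) ∘ lax2 (X ⊗ Y) Z ∘ (lax2 X Y ⊠ idm (F Z)) =
    lax2 X (Y ⊗ Z) ∘ (idm (F X) ⊠ lax2 Y Z) ∘ asso (F X) (F Y) (F Z);
  lax_unit_l : forall X : C,
    fmap F (lun X) ∘ lax2 munit X ∘ (lax0 ⊠ idm (F X)) = lun (F X);
  lax_unit_r : forall X : C,
    fmap F (run X) ∘ lax2 X munit ∘ (idm (F X) ⊠ lax0) = run (F X)
}.

Record ColaxStructure (C D : MonoidalCategory) (F : Functor C D) := {
  colax2 : forall X Y : C, F (X ⊗ Y) ~> F X ⊗ F Y;
  colax0 : F munit ~> munit;
  colax2_natural : forall (X X' Y Y' : C) (f : X ~> X') (g : Y ~> Y'),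
    colax2 X' Y' ∘ fmap F (f ⊠ g) = (fmap F f ⊠ fmap F g) ∘ colax2 X Y;
  colax_assoc : forall X Y Z : C,
    asso (F X) (F Y) (F Z) ∘ (colax2 X Y ⊠ idm (F Z)) ∘ colax2 (X ⊗ Y) Z =
    (idm (F X) ⊠ colax2 Y Z) ∘ colax2 X (Y ⊗ Z) ∘ fmap F (asso X Y Z);
  colax_unit_l : forall X : C,
    (colax0 ⊠ idm (F X)) ∘ colax2 munit X ∘ fmap F (lun_inv X) = lun_inv (F X);
  colax_unit_r : forall X : C,
    (idm (F X) ⊠ colax0) ∘ colax2 X munit ∘ fmap F (run_inv X) = run_inv (F X)
}.

Record IsBilax (C D : BraidedCategory) (F : Functor C D)
    (p : LaxStructure F) (q : ColaxStructure F) : Prop := {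
  bilax_braid : forall W X Y Z : C,
    colax2 q (W ⊗ Y) (X ⊗ Z) ∘ fmap F (interchange W X Y Z)
    ∘ lax2 p (W ⊗ X) (Y ⊗ Z) =
    (lax2 p W Y ⊠ lax2 p X Z) ∘ interchange (F W) (F X) (F Y) (F Z)
    ∘ (colax2 q W X ⊠ colax2 q Y Z);
  bilax_dup_unit :
    colax2 q munit munit ∘ fmap F (lun_inv munit) ∘ lax0 p =
    (lax0 p ⊠ lax0 p) ∘ lun_inv munit;
  bilax_mul_unit :
    colax0 q ∘ fmap F (lun munit) ∘ lax2 p munit munit =
    lun munit ∘ (colax0 q ⊠ colax0 q);
  bilax_unit : colax0 q ∘ lax0 p = idm munit
}.

Record IsBistrong (C D : BraidedCategory) (F : Functor C D)
    (p : LaxStructure F) (q : ColaxStructure F) : Prop := {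
  bistrong_bilax :> IsBilax p q;
  bistrong_lax2 : forall X Y : C, IsIso (lax2 p X Y);
  bistrong_lax0 : IsIso (lax0 p);
  bistrong_colax2 : forall X Y : C, IsIso (colax2 q X Y);
  bistrong_colax0 : IsIso (colax0 q)
}.

Definition IsBraided (C D : BraidedCategory) (F : Functor C D)
    (p : LaxStructure F) : Prop :=
  forall X Y : C,
    lax2 p Y X ∘ braid (F X) (F Y) = fmap F (braid X Y) ∘ lax2 p X Y.

Lemma comp_l (C : Category) (X Y Z : C) (f g : X ~> Y) (h : Y ~> Z) :
  f = g -> h ∘ f = h ∘ g.
Proof. intros e; rewrite e; reflexivity. Qed.

Lemma comp_r (C : Category) (X Y Z : C) (f g : Y ~> Z) (h : X ~> Y) :
  f = g -> f ∘ h = g ∘ h.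
Proof. intros e; rewrite e; reflexivity. Qed.

Lemma iso_epi (C : Category) (X Y Z : C) (e : X ~> Y) (f g : Y ~> Z) :
  IsIso e -> f ∘ e = g ∘ e -> f = g.
Proof.
  intros [i [_ h]] H.
  rewrite <- (comp_id_r f), <- (comp_id_r g), <- h, <- !comp_assoc, H.
  reflexivity.
Qed.

Lemma iso_mono (C : Category) (X Y Z : C) (e : Y ~> Z) (f g : X ~> Y) :
  IsIso e -> e ∘ f = e ∘ g -> f = g.
Proof.
  intros [i [h _]] H.
  rewrite <- (comp_id_l f), <- (comp_id_l g), <- h, !comp_assoc, H.
  reflexivity.
Qed.

Lemma iso_comp (C : Category) (X Y Z : C) (g : Y ~> Z) (f : X ~> Y) :
  IsIso g -> IsIso f -> IsIso (g ∘ f).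
Proof.
  intros [g' [g1 g2]] [f' [f1 f2]]; exists (f' ∘ g'); split.
  - rewrite comp_assoc, <- (comp_assoc g'), g1, comp_id_l; exact f1.
  - rewrite comp_assoc, <- (comp_assoc f), f2, comp_id_l; exact g2.
Qed.

Lemma iso_asso (E : MonoidalCategory) (X Y Z : E) : IsIso (asso X Y Z).
Proof. exists (asso_inv X Y Z); split; [apply asso_inv_l | apply asso_inv_r]. Qed.

Lemma iso_lun (E : MonoidalCategory) (X : E) : IsIso (lun X).
Proof. exists (lun_inv X); split; [apply lun_inv_l | apply lun_inv_r]. Qed.

Lemma iso_run (E : MonoidalCategory) (X : E) : IsIso (run X).
Proof. exists (run_inv X); split; [apply run_inv_l | apply run_inv_r]. Qed.

Lemma iso_braid (E : BraidedCategory) (X Y : E) : IsIso (braid X Y).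
Proof. exists (braid_inv X Y); split; [apply braid_inv_l | apply braid_inv_r]. Qed.

Lemma iso_tensm (E : MonoidalCategory) (X X' Y Y' : E) (f : X ~> X') (g : Y ~> Y') :
  IsIso f -> IsIso g -> IsIso (f ⊠ g).
Proof.
  intros [f' [f1 f2]] [g' [g1 g2]]; exists (f' ⊠ g'); split;
    rewrite <- tensm_comp, ?f1, ?f2, ?g1, ?g2; apply tensm_id.
Qed.

Lemma iso_idm (C : Category) (X : C) : IsIso (idm X).
Proof. exists (idm X); split; apply comp_id_l. Qed.

Lemma iso_fmap (C D : Category) (F : Functor C D) (X Y : C) (f : X ~> Y) :
  IsIso f -> IsIso (fmap F f).
Proof.
  intros [g [h k]]; exists (fmap F g); split;
    rewrite <- fmap_comp, ?h, ?k; apply fmap_id.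
Qed.

Lemma tensm_comp_l (E : MonoidalCategory) (X X' X'' Y : E)
    (g : X' ~> X'') (f : X ~> X') :
  (g ∘ f) ⊠ idm Y = (g ⊠ idm Y) ∘ (f ⊠ idm Y).
Proof. rewrite <- tensm_comp, comp_id_l; reflexivity. Qed.

Lemma tensm_comp_r (E : MonoidalCategory) (X Y Y' Y'' : E)
    (g : Y' ~> Y'') (f : Y ~> Y') :
  idm X ⊠ (g ∘ f) = (idm X ⊠ g) ∘ (idm X ⊠ f).
Proof. rewrite <- tensm_comp, comp_id_l; reflexivity. Qed.

Lemma tensm_unit_l_inj (E : MonoidalCategory) (X Y : E) (f g : X ~> Y) :
  idm munit ⊠ f = idm munit ⊠ g -> f = g.
Proof.
  intros H. apply (@iso_epi _ _ _ _ (lun X)); [apply iso_lun |].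
  rewrite <- !lun_natural, H; reflexivity.
Qed.

Lemma tensm_unit_r_inj (E : MonoidalCategory) (X Y : E) (f g : X ~> Y) :
  f ⊠ idm munit = g ⊠ idm munit -> f = g.
Proof.
  intros H. apply (@iso_epi _ _ _ _ (run X)); [apply iso_run |].
  rewrite <- !run_natural, H; reflexivity.
Qed.

Lemma lun_tens (E : MonoidalCategory) (X Y : E) :
  lun (X ⊗ Y) ∘ asso munit X Y = lun X ⊠ idm Y.
Proof.
  apply tensm_unit_l_inj.
  apply (@iso_epi _ _ _ _ (asso munit (munit ⊗ X) Y ∘ (asso munit munit X ⊠ idm Y))).
  { apply iso_comp; [apply iso_asso |].
    apply iso_tensm; [apply iso_asso | apply iso_idm]. }
  transitivity ((run munit ⊠ idm (X ⊗ Y)) ∘ asso (munit ⊗ munit) X Y).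
  - rewrite <- (triangle munit (X ⊗ Y)), comp_assoc, pentagon.
    rewrite tensm_comp_r, !comp_assoc; reflexivity.
  - rewrite <- comp_assoc, <- asso_natural, comp_assoc, <- tensm_comp, comp_id_l.
    rewrite triangle, asso_natural, tensm_id; reflexivity.
Qed.

Lemma lun_run_unit (E : MonoidalCategory) : lun munit = run munit :> (_ ~> (munit : E)).
Proof.
  apply tensm_unit_r_inj.
  rewrite <- lun_tens, <- triangle.
  apply comp_r.
  apply (@iso_mono _ _ _ _ (lun munit)); [apply iso_lun |].
  symmetry; apply lun_natural.
Qed.

Lemma lun_braid (E : BraidedCategory) (X : E) : lun X ∘ braid X munit = run X.
Proof.
  apply tensm_unit_r_inj.
  apply (@iso_mono _ _ _ _ (braid X munit)); [apply iso_braid |].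
  rewrite tensm_comp_l, <- comp_assoc.
  transitivity (lun (munit ⊗ X) ∘ ((idm munit ⊠ braid X munit)
                 ∘ asso munit X munit ∘ (braid X munit ⊠ idm munit))).
  - rewrite <- !comp_assoc, lun_natural, !comp_assoc.
    rewrite <- (comp_assoc (lun _) (asso _ _ _)), lun_tens; reflexivity.
  - rewrite <- hexagon1, <- !comp_assoc, lun_tens, <- braid_natural.
    rewrite comp_assoc, <- triangle, lun_run_unit; reflexivity.
Qed.

Lemma braid_unit (E : BraidedCategory) :
  braid munit munit = idm ((munit : E) ⊗ munit).
Proof.
  apply (@iso_mono _ _ _ _ (lun munit)); [apply iso_lun |].
  rewrite lun_braid, comp_id_r, lun_run_unit; reflexivity.
Qed.

Lemma asso_inv_natural (E : MonoidalCategory) (X X' Y Y' Z Z' : E)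
    (f : X ~> X') (g : Y ~> Y') (h : Z ~> Z') :
  asso_inv X' Y' Z' ∘ (f ⊠ (g ⊠ h)) = ((f ⊠ g) ⊠ h) ∘ asso_inv X Y Z.
Proof.
  apply (@iso_mono _ _ _ _ (asso X' Y' Z')); [apply iso_asso |].
  rewrite <- !comp_assoc, asso_inv_r, asso_natural, comp_id_l, comp_assoc.
  rewrite asso_inv_r, comp_id_r; reflexivity.
Qed.

Lemma interchange_natural (E : BraidedCategory) (W W' X X' Y Y' Z Z' : E)
    (w : W ~> W') (x : X ~> X') (y : Y ~> Y') (z : Z ~> Z') :
  interchange W' X' Y' Z' ∘ ((w ⊠ x) ⊠ (y ⊠ z)) =
  ((w ⊠ y) ⊠ (x ⊠ z)) ∘ interchange W X Y Z.
Proof.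
  unfold interchange.
  rewrite comp_assoc, asso_natural, comp_assoc.
  rewrite <- (comp_assoc (idm W' ⊠ _)), <- tensm_comp, comp_id_l.
  assert (e : asso Y' X' Z' ∘ (braid X' Y' ⊠ idm Z') ∘ asso_inv X' Y' Z'
              ∘ (x ⊠ (y ⊠ z)) =
              (y ⊠ (x ⊠ z)) ∘ (asso Y X Z ∘ (braid X Y ⊠ idm Z) ∘ asso_inv X Y Z)).
  { rewrite comp_assoc, asso_inv_natural, comp_assoc.
    rewrite <- (comp_assoc (braid X' Y' ⊠ _)), <- tensm_comp, braid_natural, comp_id_l.
    rewrite <- (comp_id_r z) at 1; rewrite tensm_comp.
    rewrite <- !comp_assoc, asso_natural; reflexivity. }
  rewrite e; clear e.
  rewrite <- (comp_id_r w) at 1; rewrite tensm_comp.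
  rewrite <- !comp_assoc, asso_inv_natural; reflexivity.
Qed.

Lemma interchange_unit (E : BraidedCategory) (W Z : E) :
  interchange W munit munit Z = idm _.
Proof.
  unfold interchange.
  rewrite braid_unit, tensm_id, comp_id_r, asso_inv_r, tensm_id, comp_id_r.
  apply asso_inv_l.
Qed.

Lemma lax0_colax0 (C D : BraidedCategory) (F : Functor C D)
    (p : LaxStructure F) (q : ColaxStructure F) (S : IsBistrong p q) :
  lax0 p ∘ colax0 q = idm _.
Proof.
  apply (@iso_epi _ _ _ _ (lax0 p)); [apply (bistrong_lax0 S) |].
  rewrite comp_assoc, (bilax_unit S), comp_id_l, comp_id_r; reflexivity.
Qed.

Lemma lax2_colax2 (C D : BraidedCategory) (F : Functor C D)
    (p : LaxStructure F) (q : ColaxStructure F) (S : IsBistrong p q) (X Y : C) :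
  lax2 p X Y ∘ colax2 q X Y = idm _.
Proof.
  apply (@iso_epi _ _ _ _ (lax2 p X Y)); [apply (bistrong_lax2 S) |].
  rewrite comp_assoc, comp_id_l.
  transitivity (lax2 p X Y ∘ idm (F X ⊗ F Y)); [apply comp_l | apply comp_id_r].
  apply (@iso_epi _ _ _ _ (fmap F (run X) ⊠ fmap F (lun Y))).
  { apply iso_tensm; apply iso_fmap; [apply iso_run | apply iso_lun]. }
  rewrite comp_id_l, comp_assoc, lax2_natural, <- comp_assoc, colax2_natural.
  rewrite comp_assoc.
  generalize (bilax_braid S X munit munit Y).
  rewrite interchange_unit, fmap_id, comp_id_r; intros e; rewrite e; clear e.
  rewrite <- !comp_assoc, <- tensm_comp.
  assert (r : fmap F (run X) ∘ lax2 p X munit = run (F X) ∘ (idm (F X) ⊠ colax0 q)).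
  { rewrite <- (lax_unit_r p), comp_assoc, <- tensm_comp, (lax0_colax0 S).
    rewrite comp_id_l, tensm_id, comp_id_r; reflexivity. }
  assert (l : fmap F (lun Y) ∘ lax2 p munit Y = lun (F Y) ∘ (colax0 q ⊠ idm (F Y))).
  { rewrite <- (lax_unit_l p), comp_assoc, <- tensm_comp, (lax0_colax0 S).
    rewrite comp_id_l, tensm_id, comp_id_r; reflexivity. }
  rewrite r, l; clear r l.
  assert (n : ((run (F X) ∘ (idm (F X) ⊠ colax0 q)) ⊠ (lun (F Y) ∘ (colax0 q ⊠ idm (F Y))))
              ∘ interchange (F X) (F munit) (F munit) (F Y) =
              (run (F X) ∘ (idm (F X) ⊠ colax0 q)) ⊠ (lun (F Y) ∘ (colax0 q ⊠ idm (F Y)))).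
  { rewrite tensm_comp, comp_assoc.
    apply comp_l.
    transitivity (interchange (F X) munit munit (F Y)
                  ∘ ((idm (F X) ⊠ colax0 q) ⊠ (colax0 q ⊠ idm (F Y)))).
    - symmetry; apply interchange_natural.
    - rewrite interchange_unit, comp_id_l; reflexivity. }
  rewrite n, <- tensm_comp; clear n; f_equal.
  - apply (@iso_epi _ _ _ _ (fmap F (run_inv X))).
    { apply iso_fmap; exists (run X); split; [apply run_inv_r | apply run_inv_l]. }
    rewrite (comp_assoc _ _ (fmap F (run_inv X))), (comp_assoc (run _)).
    rewrite <- (comp_assoc (_ ⊠ _)), colax_unit_r, run_inv_r.
    rewrite <- fmap_comp, run_inv_r, fmap_id; reflexivity.
  - apply (@iso_epi _ _ _ _ (fmap F (lun_inv Y))).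
    { apply iso_fmap; exists (lun Y); split; [apply lun_inv_r | apply lun_inv_l]. }
    rewrite (comp_assoc _ _ (fmap F (lun_inv Y))), (comp_assoc (lun _)).
    rewrite <- (comp_assoc (_ ⊠ _)), colax_unit_l, lun_inv_r.
    rewrite <- fmap_comp, lun_inv_r, fmap_id; reflexivity.
Qed.

Lemma induced_mul_assoc (C D : MonoidalCategory) (F : Functor C D)
    (p : LaxStructure F) (M : C) (a : MonoidOn M) :
  let m := fmap F (mul a) ∘ lax2 p M M in
  m ∘ (m ⊠ idm (F M)) = m ∘ (idm (F M) ⊠ m) ∘ asso (F M) (F M) (F M).
Proof.
  simpl.
  rewrite tensm_comp_l, tensm_comp_r, <- (fmap_id F M), !comp_assoc.
  rewrite <- (comp_assoc (lax2 p M M) (_ ⊠ _) (_ ⊠ _)), lax2_natural.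
  rewrite <- (comp_assoc (lax2 p M M) (_ ⊠ _) (_ ∘ _)), lax2_natural.
  rewrite (comp_assoc _ (lax2 p M _) (_ ∘ _)), fmap_id.
  rewrite <- (comp_assoc (lax2 p M _)), <- lax_assoc.
  rewrite <- !comp_assoc, <- !fmap_comp, mul_assoc; reflexivity.
Qed.

Lemma induced_dup_assoc (C D : MonoidalCategory) (F : Functor C D)
    (q : ColaxStructure F) (K : C) (c : ComonoidOn K) :
  let d := colax2 q K K ∘ fmap F (dup c) in
  asso (F K) (F K) (F K) ∘ (d ⊠ idm (F K)) ∘ d = (idm (F K) ⊠ d) ∘ d.
Proof.
  simpl.
  rewrite tensm_comp_l, tensm_comp_r, <- (fmap_id F K), !comp_assoc.
  rewrite <- !(comp_assoc (_ ⊠ _) (colax2 q K K) _), <- !colax2_natural.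
  rewrite !comp_assoc, <- !fmap_comp, <- dup_assoc, fmap_id.
  rewrite !fmap_comp.
  rewrite <- !comp_assoc, colax_assoc; reflexivity.
Qed.

Definition induced_monoid (C D : MonoidalCategory) (F : Functor C D)
    (p : LaxStructure F) (M : C) (a : MonoidOn M) : MonoidOn (F M).
Proof.
  refine {|
    mul := fmap F (mul a) ∘ lax2 p M M;
    one := fmap F (one a) ∘ lax0 p;
    mul_assoc := induced_mul_assoc p a
  |}.
  - abstract (
      rewrite tensm_comp_l, <- (fmap_id F M), comp_assoc,
        <- (comp_assoc (lax2 p M M)), lax2_natural, fmap_id,
        <- (lax_unit_l p), <- !comp_assoc, <- fmap_comp, mul_one_l; reflexivity).
  - abstract (
      rewrite tensm_comp_r, <- (fmap_id F M), comp_assoc,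
        <- (comp_assoc (lax2 p M M)), lax2_natural, fmap_id,
        <- (lax_unit_r p), <- !comp_assoc, <- fmap_comp, mul_one_r; reflexivity).
Defined.

Definition induced_comonoid (C D : MonoidalCategory) (F : Functor C D)
    (q : ColaxStructure F) (K : C) (c : ComonoidOn K) : ComonoidOn (F K).
Proof.
  refine {|
    dup := colax2 q K K ∘ fmap F (dup c);
    del := colax0 q ∘ fmap F (del c);
    dup_assoc := induced_dup_assoc q c
  |}.
  - abstract (
      rewrite tensm_comp_l, <- (fmap_id F K), comp_assoc,
        <- (comp_assoc (_ ⊠ _) (colax2 q K K)), <- colax2_natural, fmap_id,
        <- (colax_unit_l q), !comp_assoc, <- fmap_comp, dup_del_l; reflexivity).
  - abstract (
      rewrite tensm_comp_r, <- (fmap_id F K), comp_assoc,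
        <- (comp_assoc (_ ⊠ _) (colax2 q K K)), <- colax2_natural, fmap_id,
        <- (colax_unit_r q), !comp_assoc, <- fmap_comp, dup_del_r; reflexivity).
Defined.

Definition induced_bimonoid (C D : BraidedCategory) (F : Functor C D)
    (p : LaxStructure F) (q : ColaxStructure F) (S : IsBilax p q)
    (B : Bimonoid C) : Bimonoid D.
Proof.
  refine {|
    bi_mon := induced_monoid p (bi_mon B);
    bi_com := induced_comonoid q (bi_com B)
  |}; cbn [induced_monoid induced_comonoid mul one dup del].
  - abstract (
      rewrite !tensm_comp, !comp_assoc,
        <- (comp_assoc (fmap F (dup _))), <- fmap_comp, bi_dup_mul, !fmap_comp,
        !comp_assoc, <- lax2_natural,
        <- (comp_assoc (colax2 q _ _)), colax2_natural, !comp_assoc;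
      apply comp_l;
      rewrite <- !comp_assoc, (bilax_braid S); reflexivity).
  - abstract (
      rewrite comp_assoc, <- (comp_assoc (fmap F (del _))), <- fmap_comp,
        bi_del_one, fmap_id, comp_id_l; apply (bilax_unit S)).
  - abstract (
      rewrite tensm_comp, <- (comp_assoc (lun munit)), <- (bilax_mul_unit S), !comp_assoc,
        lax2_natural, <- !(comp_assoc (fmap F _) (fmap F _)), <- !fmap_comp,
        bi_del_mul; reflexivity).
  - abstract (
      rewrite tensm_comp, (comp_assoc (_ ⊠ _) (_ ⊠ _)), <- (bilax_dup_unit S), <- !comp_assoc,
        <- colax2_natural, !comp_assoc, <- !(comp_assoc (fmap F _) (fmap F _)),
        <- !fmap_comp, bi_dup_one; reflexivity).
Defined.

Lemma induced_morphism (C D : BraidedCategory) (F : Functor C D)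
    (p : LaxStructure F) (q : ColaxStructure F) (S : IsBilax p q)
    (A B : Bimonoid C) (f : A ~> B) :
  IsBimonoidMorphism f ->
  IsBimonoidMorphism (A := induced_bimonoid S A) (B := induced_bimonoid S B)
    (fmap F f).
Proof.
  intros [f1 f2 f3 f4]; split; simpl.
  - rewrite <- comp_assoc, <- fmap_comp, f1, fmap_comp, !comp_assoc, lax2_natural.
    reflexivity.
  - rewrite <- comp_assoc, <- fmap_comp, f2; reflexivity.
  - rewrite comp_assoc, <- fmap_comp, f3, fmap_comp, <- !comp_assoc, colax2_natural.
    reflexivity.
  - rewrite comp_assoc, <- fmap_comp, f4; reflexivity.
Qed.

Definition BimonoidFunctor (C D : BraidedCategory) (F : Functor C D)
    (p : LaxStructure F) (q : ColaxStructure F) (S : IsBilax p q) :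
    Functor (BimonoidCategory C) (BimonoidCategory D).
Proof.
  refine (Build_Functor (C := BimonoidCategory C) (D := BimonoidCategory D)
    (fob := induced_bimonoid S)
    (fmap := fun A B f => exist _ (fmap F (proj1_sig f))
                            (induced_morphism S (proj2_sig f))) _ _);
  abstract (intros; apply sig_ext; first [apply fmap_id | apply fmap_comp]).
Defined.

Lemma induced_antipode (C D : BraidedCategory) (F : Functor C D)
    (p : LaxStructure F) (q : ColaxStructure F) (S : IsBistrong p q)
    (H : Bimonoid C) (s : H ~> H) :
  ConvolutionInverse (bi_com H) (bi_mon H) (idm H) s ->
  ConvolutionInverse (bi_com (induced_bimonoid S H))
    (bi_mon (induced_bimonoid S H)) (idm (F H)) (fmap F s).
Proof.
  assert (conv : forall f g : H ~> H,
    convolution (bi_com (induced_bimonoid S H)) (bi_mon (induced_bimonoid S H))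
      (fmap F f) (fmap F g) =
    fmap F (convolution (bi_com H) (bi_mon H) f g)).
  { intros f g; unfold convolution; simpl.
    rewrite !comp_assoc, <- (comp_assoc (_ ⊠ _)), <- colax2_natural.
    rewrite !comp_assoc, <- (comp_assoc (lax2 p _ _)), (lax2_colax2 S), comp_id_l.
    rewrite !fmap_comp; reflexivity. }
  assert (unit : convolution_unit (bi_com (induced_bimonoid S H))
      (bi_mon (induced_bimonoid S H)) =
    fmap F (convolution_unit (bi_com H) (bi_mon H))).
  { unfold convolution_unit; simpl.
    rewrite comp_assoc, <- (comp_assoc (lax0 p)), (lax0_colax0 S), comp_id_l.
    symmetry; apply fmap_comp. }
  unfold ConvolutionInverse; intros [h1 h2].
  rewrite <- (fmap_id F H), unit, !conv, h1, h2; split; reflexivity.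
Qed.

Lemma induced_hopf (C D : BraidedCategory) (F : Functor C D)
    (p : LaxStructure F) (q : ColaxStructure F) (S : IsBistrong p q)
    (H : Bimonoid C) : IsHopf H -> IsHopf (BimonoidFunctor S H).
Proof.
  intros [s hs]; exists (fmap F s); exact (induced_antipode S hs).
Qed.

Definition HopfFunctor (C D : BraidedCategory) (F : Functor C D)
    (p : LaxStructure F) (q : ColaxStructure F) (S : IsBistrong p q) :
    Functor (Hopf C) (Hopf D) :=
  RestrictFunctor (F := BimonoidFunctor S) (induced_hopf S).

(* Main.v *)
From Stdlib Require Import IndefiniteDescription FinFun List ProofIrrelevance.
Require Import Defs.
Set Implicit Arguments.
Unset Strict Implicit.
Unset Printing Implicit Defensive.
Local Open Scope cat_scope.

(** In a cartesian category every object has exactly one comonoid structure,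
    the diagonal, so a Hopf monoid in [C] is a group object and a bimonoid
    morphism between two of them is a group homomorphism.  Since [L] is
    braided and strong, it sends the diagonal of [X] to a cocommutative
    comonoid [L X].

    Let [H] be a Hopf monoid in [D] with antipode [s].  The maps [X ~> R H]
    whose transposes [L X ~> H] respect the comonoid structures are those that
    equalize two maps out of [R H]; hence their equalizer [G] carries a
    universal comonoid morphism [ε : L G ~> H], and [Hom(X, G)] is naturally
    the set of comonoid morphisms [L X ~> H] ([cofree_comonoid]).

    Because [L X] is cocommutative and [H] is a bimonoid, these comonoid
    morphisms are closed under convolution; because [H] is Hopf they form a
    group, the inverse of [f] being [s ∘ f].  The only delicate point is that
    [s ∘ f] is again a comonoid morphism ([antipode_comonoid_morphism]), the
    relative form of the fact that antipodes reverse comultiplication.  By the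
    Yoneda lemma [G] is a group object ([group_object]).

    Finally, transposition along [ε] matches the homomorphisms [X ~> G] with
    the bimonoid morphisms [L X ~> H] ([points_morphism_iff]), so [ε] is a
    couniversal arrow from the induced functor to [H], and a functor that
    admits couniversal arrows to all objects has a right adjoint. *)

(** * Calculating with composites and tensors *)

Lemma whisker (C : Category) (W X Y Z : C) (g : Y ~> Z) (f : X ~> Y)
    (k : X ~> Z) (h : W ~> X) :
  g ∘ f = k -> g ∘ (f ∘ h) = k ∘ h.
Proof. intros e; rewrite <- comp_assoc, e; reflexivity. Qed.

(** Composites are kept associated to the right; [rw] applies an equation whose
    left side is a composite of two arrows anywhere inside such a chain, and
    [rwr] does so from right to left. *)
Tactic Notation "rw" uconstr(H) :=
  rewrite ?comp_assoc; first [rewrite (whisker _ H) | rewrite H];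
  rewrite ?comp_assoc.
Tactic Notation "rwr" uconstr(H) :=
  rewrite ?comp_assoc; first [rewrite (whisker _ (eq_sym H)) | rewrite <- H];
  rewrite ?comp_assoc.

Ltac merge := rewrite <- ?tensm_comp, ?comp_id_l, ?comp_id_r.

Lemma tensm_split_l (E : MonoidalCategory) (X X' Y Y' : E) (f : X ~> X') (g : Y ~> Y') :
  (f ⊠ idm Y') ∘ (idm X ⊠ g) = f ⊠ g.
Proof. rewrite <- tensm_comp, comp_id_l, comp_id_r; reflexivity. Qed.

Lemma tensm_split_r (E : MonoidalCategory) (X X' Y Y' : E) (f : X ~> X') (g : Y ~> Y') :
  (idm X' ⊠ g) ∘ (f ⊠ idm Y) = f ⊠ g.
Proof. rewrite <- tensm_comp, comp_id_l, comp_id_r; reflexivity. Qed.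

Lemma lun_inv_natural (E : MonoidalCategory) (X Y : E) (f : X ~> Y) :
  (idm munit ⊠ f) ∘ lun_inv X = lun_inv Y ∘ f.
Proof.
  apply (iso_mono (iso_lun Y)).
  rw (lun_natural f). rw (lun_inv_r Y). rewrite lun_inv_r, comp_id_l, comp_id_r.
  reflexivity.
Qed.

(** * Convolution with values in a module *)

(** Acting on a module generalizes convolution, which is the case of the
    regular module.  The added generality serves the two actions of a bimonoid
    [H] on [H ⊗ H], one on each factor: they do the work of the tensor product
    monoid [H ⊗ H], whose associativity is a much longer coherence
    calculation. *)
Record LeftModule {E : MonoidalCategory} {A : E} (a : MonoidOn A) (N : E) := {
  act : A ⊗ N ~> N;
  act_mul : act ∘ (mul a ⊠ idm N) = act ∘ (idm A ⊠ act) ∘ asso A A N;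
  act_one : act ∘ (one a ⊠ idm N) = lun N
}.

Definition regular_module {E : MonoidalCategory} {A : E} (a : MonoidOn A) :
    LeftModule a A :=
  {| act := mul a; act_mul := mul_assoc a; act_one := mul_one_l a |}.

Definition convolution_act {E : MonoidalCategory} {K A N : E} (c : ComonoidOn K)
    {a : MonoidOn A} (M : LeftModule a N) (f : K ~> A) (n : K ~> N) : K ~> N :=
  act M ∘ (f ⊠ n) ∘ dup c.

Section ConvolutionAction.
Context {E : MonoidalCategory} {K A N : E} (c : ComonoidOn K) (a : MonoidOn A)
  (M : LeftModule a N).

Lemma convolution_act_mul (f g : K ~> A) (n : K ~> N) :
  convolution_act c M (convolution c a f g) n =
  convolution_act c M f (convolution_act c M g n).
Proof.
  unfold convolution_act, convolution.
  rewrite <- (comp_id_r n) at 1.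
  rewrite <- (comp_id_l f) at 2.
  rewrite <- (comp_id_r (idm A ∘ f)).
  rewrite <- (comp_id_l n) at 1.
  rewrite !tensm_comp.
  rw (act_mul M). rw (asso_natural _ _ _).
  rwr (dup_assoc c). reflexivity.
Qed.

Lemma convolution_act_unit (n : K ~> N) :
  convolution_act c M (convolution_unit c a) n = n.
Proof.
  unfold convolution_act, convolution_unit.
  replace ((one a ∘ del c) ⊠ n)
    with ((one a ⊠ idm N) ∘ (idm munit ⊠ n) ∘ (del c ⊠ idm K))
    by (merge; reflexivity).
  rw (dup_del_l c). rw (act_one M). rw (lun_natural n).
  rewrite lun_inv_r; apply comp_id_r.
Qed.
End ConvolutionAction.

Lemma convolution_unit_r (E : MonoidalCategory) (K A : E) (c : ComonoidOn K)
    (a : MonoidOn A) (f : K ~> A) :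
  convolution c a f (convolution_unit c a) = f.
Proof.
  unfold convolution, convolution_unit.
  replace (f ⊠ (one a ∘ del c))
    with ((idm A ⊠ one a) ∘ (f ⊠ idm munit) ∘ (idm K ⊠ del c))
    by (merge; reflexivity).
  rw (dup_del_r c). rw (mul_one_r a). rw (run_natural f).
  rewrite run_inv_r; apply comp_id_r.
Qed.

Record IsComonoidMorphism {E : MonoidalCategory} {K K' : E} (c : ComonoidOn K)
    (c' : ComonoidOn K') (f : K ~> K') : Prop := {
  com_dup : dup c' ∘ f = (f ⊠ f) ∘ dup c;
  com_del : del c' ∘ f = del c
}.

Section Precomposition.
Context {E : MonoidalCategory} {K K' A : E} {c : ComonoidOn K}
  {c' : ComonoidOn K'} {h : K ~> K'} (hh : IsComonoidMorphism c c' h)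
  (a : MonoidOn A).

Lemma convolution_precomp (f g : K' ~> A) :
  convolution c' a f g ∘ h = convolution c a (f ∘ h) (g ∘ h).
Proof.
  unfold convolution. rw (com_dup hh). rewrite tensm_comp, !comp_assoc.
  reflexivity.
Qed.

Lemma convolution_unit_precomp :
  convolution_unit c' a ∘ h = convolution_unit c a.
Proof. unfold convolution_unit. rw (com_del hh). reflexivity. Qed.

End Precomposition.

(** * The two actions on a tensor product in a braided category *)

(** The mirror image of [lun_braid]: in the second hexagon for [munit], [munit],
    [X] everything but the two sides of the claim cancels. *)
Lemma run_braid (E : BraidedCategory) (X : E) : run X ∘ braid munit X = lun X.
Proof.
  apply tensm_unit_r_inj. rewrite <- lun_tens.
  apply (iso_epi (e := asso_inv munit X munit ∘ (idm munit ⊠ braid munit X))).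
  { apply iso_comp; [exists (asso munit X munit); split;
      [apply asso_inv_r | apply asso_inv_l]
    | apply iso_tensm; [apply iso_idm | apply iso_braid]]. }
  rw (asso_inv_r _ _ _). rewrite comp_id_l, lun_natural.
  rewrite tensm_comp_l, !comp_assoc.
  rewrite <- (comp_assoc _ (asso_inv munit X munit)), <- hexagon2.
  rewrite <- triangle. rw (asso_inv_r _ _ _). rewrite comp_id_l.
  rwr (braid_natural _ _). apply comp_l.
  apply (iso_epi (iso_asso munit munit X)).
  rw (asso_inv_l _ _ _). rewrite comp_id_r. symmetry; apply lun_tens.
Qed.

(** The factor of [interchange] that carries the braiding; an action on the
    second factor of a tensor product moves past the first factor by it. *)
Definition swap_head {E : BraidedCategory} (X Y Z : E) :
    X ⊗ (Y ⊗ Z) ~> Y ⊗ (X ⊗ Z) :=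
  asso Y X Z ∘ (braid X Y ⊠ idm Z) ∘ asso_inv X Y Z.

Lemma swap_head_natural (E : BraidedCategory) (X X' Y Y' Z Z' : E)
    (x : X ~> X') (y : Y ~> Y') (z : Z ~> Z') :
  swap_head X' Y' Z' ∘ (x ⊠ (y ⊠ z)) = (y ⊠ (x ⊠ z)) ∘ swap_head X Y Z.
Proof.
  unfold swap_head.
  rw (asso_inv_natural _ _ _).
  rewrite <- (comp_assoc (braid X' Y' ⊠ _)), <- tensm_comp, braid_natural, comp_id_l.
  rewrite <- (comp_id_r z) at 1; rewrite tensm_comp.
  rewrite <- !comp_assoc, asso_natural; reflexivity.
Qed.

Lemma pentagon_inv (E : MonoidalCategory) (W X Y Z : E) :
  asso_inv (W ⊗ X) Y Z ∘ asso_inv W X (Y ⊗ Z) =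
  (asso_inv W X Y ⊠ idm Z) ∘ asso_inv W (X ⊗ Y) Z ∘ (idm W ⊠ asso_inv X Y Z).
Proof.
  apply (iso_epi (e := asso W X (Y ⊗ Z) ∘ asso (W ⊗ X) Y Z)).
  { apply iso_comp; apply iso_asso. }
  rw (asso_inv_l _ _ _). rewrite comp_id_l, asso_inv_l, pentagon.
  rewrite !comp_assoc.
  rewrite <- (comp_assoc (idm W ⊠ asso_inv _ _ _)), <- tensm_comp_r, asso_inv_l.
  rewrite tensm_id, comp_id_l. rw (asso_inv_l _ _ _). rewrite comp_id_l.
  rewrite <- tensm_comp_l, asso_inv_l, tensm_id; reflexivity.
Qed.

Lemma pentagon_mixed (E : MonoidalCategory) (W X Y Z : E) :
  asso_inv W X (Y ⊗ Z) ∘ (idm W ⊠ asso X Y Z) =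
  asso (W ⊗ X) Y Z ∘ (asso_inv W X Y ⊠ idm Z) ∘ asso_inv W (X ⊗ Y) Z.
Proof.
  apply (iso_mono (iso_asso W X (Y ⊗ Z))).
  rw (asso_inv_r _ _ _). rewrite comp_id_l. rw (pentagon _ _ _ _).
  rewrite <- (comp_assoc (asso W X Y ⊠ _)), <- tensm_comp_l, asso_inv_r.
  rewrite tensm_id, comp_id_l, asso_inv_r; symmetry; apply comp_id_r.
Qed.

(** The second hexagon with a spectator [Z] and all associators written out:
    moving [X ⊗ X'] past [Y] is moving [X'] and then [X].  This is what makes
    [second_factor_module] associative. *)
Lemma swap_head_tens (E : BraidedCategory) (X X' Y Z : E) :
  swap_head X Y (X' ⊗ Z) ∘ (idm X ⊠ swap_head X' Y Z) ∘ asso X X' (Y ⊗ Z) =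
  (idm Y ⊠ asso X X' Z) ∘ swap_head (X ⊗ X') Y Z.
Proof.
  (* Without the trailing associator the left side collapses, by two
     pentagons, to the right side of the hexagon tensored with [Z]. *)
  apply (iso_epi (e := asso_inv X X' (Y ⊗ Z))).
  { exists (asso X X' (Y ⊗ Z)); split; [apply asso_inv_r | apply asso_inv_l]. }
  unfold swap_head. rewrite !tensm_comp_r. rw (asso_inv_r _ _ _).
  rewrite comp_id_r.
  rw (pentagon_mixed _ _ _ _). rw (asso_inv_natural _ _ _).
  rewrite <- (tensm_id X' Z).
  rwr (asso_natural _ _ _).
  rw (pentagon_inv _ _ _ _).
  rewrite <- !(comp_assoc (_ ⊠ idm Z) (_ ⊠ idm Z)), <- !tensm_comp_l.
  rewrite <- !(comp_assoc (_ ⊠ idm Z) (_ ⊠ idm Z)), <- !tensm_comp_l.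
  rewrite <- hexagon2.
  rw (pentagon _ _ _ _).
  rewrite <- !(comp_assoc (_ ⊠ idm Z) (_ ⊠ idm Z)), <- !tensm_comp_l.
  rewrite <- !comp_assoc, asso_inv_r, comp_id_l.
  reflexivity.
Qed.

Definition first_factor_module {E : MonoidalCategory} {A : E} (a : MonoidOn A)
    (N : E) : LeftModule a (A ⊗ N).
Proof.
  refine {| act := (mul a ⊠ idm N) ∘ asso_inv A A N |}.
  - rewrite <- (tensm_id A N). rw (asso_inv_natural _ _ _).
    rewrite <- (comp_assoc (_ ⊠ idm N)), <- tensm_comp_l, mul_assoc.
    rewrite !tensm_comp_r. rw (asso_inv_natural _ _ _).
    rewrite !tensm_comp_l, !comp_assoc. do 2 apply comp_l.
    apply (iso_epi (e := asso_inv A A (A ⊗ N))).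
    { exists (asso A A (A ⊗ N)); split; [apply asso_inv_r | apply asso_inv_l]. }
    rw (pentagon_inv _ _ _ _). rw (asso_inv_r _ _ _).
    rewrite <- (comp_assoc (_ ⊠ idm N)), <- tensm_comp_l, asso_inv_r.
    rewrite tensm_id, comp_id_l, comp_id_r; reflexivity.
  - rewrite <- (tensm_id A N). rw (asso_inv_natural _ _ _).
    rewrite <- (comp_assoc (_ ⊠ idm N)), <- tensm_comp_l, mul_one_l.
    rewrite <- lun_tens. rw (asso_inv_r _ _ _). apply comp_id_r.
Defined.

Definition second_factor_module {E : BraidedCategory} {A N : E} {a : MonoidOn A}
    (M : LeftModule a N) (B : E) : LeftModule a (B ⊗ N).
Proof.
  refine {| act := (idm B ⊠ act M) ∘ swap_head A B N |}.
  - rewrite <- (tensm_id B N). rw (swap_head_natural _ _ _).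
    rewrite <- (comp_assoc (idm B ⊠ _)), <- tensm_comp_r, act_mul.
    rewrite !tensm_comp_r. rw (swap_head_natural _ _ _).
    rwr (swap_head_tens _ _ _ _). reflexivity.
  - rewrite <- (tensm_id B N). rw (swap_head_natural _ _ _).
    rewrite <- (comp_assoc (idm B ⊠ _)), <- tensm_comp_r, act_one.
    unfold swap_head. rw (triangle _ _).
    rewrite <- (comp_assoc (_ ⊠ idm N)), <- tensm_comp_l, run_braid.
    rewrite <- lun_tens. rw (asso_inv_r _ _ _). apply comp_id_r.
Defined.

(** * Comonoid morphisms from a cocommutative comonoid to a bimonoid *)

Definition Cocommutative {E : BraidedCategory} {K : E} (c : ComonoidOn K) : Prop :=
  braid K K ∘ dup c = dup c.

(** Cocommutativity in the form needed under associators: the first two of three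
    copies of [K] may be exchanged. *)
Lemma swap_head_dup (E : BraidedCategory) (K : E) (c : ComonoidOn K) :
  Cocommutative c ->
  swap_head K K K ∘ (idm K ⊠ dup c) ∘ dup c = (idm K ⊠ dup c) ∘ dup c.
Proof.
  intros hc; unfold swap_head. rewrite <- dup_assoc.
  rewrite comp_assoc, <- (dup_assoc c). rw (asso_inv_l K K K). rewrite comp_id_l.
  rewrite <- (comp_assoc (braid K K ⊠ _)), <- tensm_comp_l, hc; reflexivity.
Qed.

Section ComonoidMorphismsIntoBimonoid.
Context {E : BraidedCategory} {K : E} {c : ComonoidOn K} {H : Bimonoid E}.

Let first := first_factor_module (bi_mon H) H.
Let second := second_factor_module (regular_module (bi_mon H)) H.

(** Comultiplication is multiplicative, and multiplying by [f1 ⊗ f2] in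
    [H ⊗ H] is acting by [f2] on the second factor, then by [f1] on the
    first. *)
Lemma dup_convolution (f n : K ~> H) (hf : IsComonoidMorphism c (bi_com H) f) :
  dup (bi_com H) ∘ convolution c (bi_mon H) f n =
  convolution_act c first f (convolution_act c second f (dup (bi_com H) ∘ n)).
Proof.
  unfold convolution, convolution_act; simpl.
  rw (bi_dup_mul H).
  rewrite <- (comp_assoc (dup _ ⊠ dup _)), <- tensm_comp, (com_dup hf).
  rewrite <- (comp_id_r (dup (bi_com H) ∘ n)) at 1.
  rewrite tensm_comp. unfold interchange.
  rw (asso_natural _ _ _).
  rewrite <- (comp_assoc (asso K K K)), dup_assoc.
  rewrite <- (comp_assoc (asso H H H)); fold (swap_head (bi_ob H) H H).
  rewrite <- (tensm_split_l (mul (bi_mon H)) (mul (bi_mon H))).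
  rewrite <- (tensm_id H H). rwr (asso_inv_natural _ _ (mul (bi_mon H))).
  do 2 apply comp_l. rewrite <- !comp_assoc. apply comp_r.
  merge; rewrite !comp_assoc; reflexivity.
Qed.

Lemma convolution_act_first (f g k : K ~> H) :
  convolution_act c first f ((g ⊠ k) ∘ dup c) =
  (convolution c (bi_mon H) f g ⊠ k) ∘ dup c.
Proof.
  unfold convolution_act, convolution; simpl.
  replace (f ⊠ ((g ⊠ k) ∘ dup c)) with ((f ⊠ (g ⊠ k)) ∘ (idm K ⊠ dup c))
    by (merge; reflexivity).
  rw (asso_inv_natural _ _ _). rewrite <- (dup_assoc c).
  rw (asso_inv_l K K K). rewrite comp_id_l, <- !comp_assoc.
  merge; reflexivity.
Qed.

Lemma convolution_act_second (hc : Cocommutative c) (f g k : K ~> H) :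
  convolution_act c second f ((g ⊠ k) ∘ dup c) =
  (g ⊠ convolution c (bi_mon H) f k) ∘ dup c.
Proof.
  unfold convolution_act, convolution; simpl.
  replace (f ⊠ ((g ⊠ k) ∘ dup c)) with ((f ⊠ (g ⊠ k)) ∘ (idm K ⊠ dup c))
    by (merge; reflexivity).
  rw (swap_head_natural _ _ _).
  rewrite <- (comp_assoc (swap_head _ _ _)), (swap_head_dup hc), <- !comp_assoc.
  merge; reflexivity.
Qed.

(** A cocommutative comultiplication is itself a comonoid morphism: exchanging
    the two middle copies of [K] among four changes nothing. *)
Lemma dup_interchange (hc : Cocommutative c) :
  interchange K K K K ∘ (dup c ⊠ dup c) ∘ dup c = (dup c ⊠ dup c) ∘ dup c.
Proof.
  assert (e : asso K K (K ⊗ K) ∘ (dup c ⊠ dup c) ∘ dup c =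
    (idm K ⊠ ((idm K ⊠ dup c) ∘ dup c)) ∘ dup c).
  { rewrite <- (tensm_split_r (dup c) (dup c)), <- (tensm_id K K).
    rw (asso_natural _ _ _).
    rewrite <- (comp_assoc (asso K K K)), dup_assoc.
    rewrite <- (comp_assoc _ (idm K ⊠ dup c)), <- tensm_comp_r.
    reflexivity. }
  unfold interchange; fold (swap_head K K K).
  rewrite !comp_assoc, <- (comp_assoc (asso K K (K ⊗ K))), e.
  rewrite <- (comp_assoc (idm K ⊠ _) (idm K ⊠ _)), <- tensm_comp_r.
  rewrite <- (comp_assoc (swap_head K K K)), (swap_head_dup hc), <- e.
  rw (asso_inv_l _ _ _). apply comp_id_l.
Qed.

Lemma convolution_unit_comonoid_morphism :
  IsComonoidMorphism c (bi_com H) (convolution_unit c (bi_mon H)).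
Proof.
  unfold convolution_unit; split.
  - rw (bi_dup_one H). rewrite tensm_comp.
    rewrite <- (tensm_split_r (del c)). rw (dup_del_l c).
    rw (lun_inv_natural _). reflexivity.
  - rw (bi_del_one H). apply comp_id_l.
Qed.

Lemma convolution_comonoid_morphism (hc : Cocommutative c) (f g : K ~> H) :
  IsComonoidMorphism c (bi_com H) f -> IsComonoidMorphism c (bi_com H) g ->
  IsComonoidMorphism c (bi_com H) (convolution c (bi_mon H) f g).
Proof.
  intros hf hg; unfold convolution; split.
  - rw (bi_dup_mul H).
    rewrite <- (comp_assoc (dup _ ⊠ dup _)), <- tensm_comp, (com_dup hf), (com_dup hg).
    rewrite tensm_comp. rw (interchange_natural _ _ _ _).
    rewrite <- (comp_assoc (interchange _ _ _ _)), (dup_interchange hc).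
    rewrite !tensm_comp, !comp_assoc; reflexivity.
  - rw (bi_del_mul H). rewrite <- (comp_assoc (del _ ⊠ del _)), <- tensm_comp.
    rewrite (com_del hf), (com_del hg).
    rewrite <- (tensm_split_r (del c)). rw (dup_del_l c). rw (lun_natural _).
    rewrite lun_inv_r; apply comp_id_r.
Qed.

(** Write [n] for [dup ∘ s ∘ f].  Applying [dup] to [f * (s ∘ f) = 1] shows that
    acting on [n] by [f] in the second factor and then in the first gives the
    unit of [H ⊗ H].  Each action by [f] is undone by the action by [s ∘ f], so
    [n] is obtained from [1 ⊗ 1] by letting [s ∘ f] act on the first factor
    and then on the second.  Cocommutativity of [K] allows the copies of its
    argument to be permuted, and the result is [((s ∘ f) ⊠ (s ∘ f)) ∘ dup c]. *)
Lemma antipode_comonoid_morphism (hc : Cocommutative c) (s : H ~> H)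
    (hs : ConvolutionInverse (bi_com H) (bi_mon H) (idm H) s) (f : K ~> H) :
  IsComonoidMorphism c (bi_com H) f -> IsComonoidMorphism c (bi_com H) (s ∘ f).
Proof.
  intros hf.
  assert (r : convolution c (bi_mon H) f (s ∘ f) = convolution_unit c (bi_mon H)).
  { rewrite <- (comp_id_l f) at 1.
    rewrite <- (convolution_precomp hf), (proj1 hs).
    apply (convolution_unit_precomp hf). }
  assert (l : convolution c (bi_mon H) (s ∘ f) f = convolution_unit c (bi_mon H)).
  { rewrite <- (comp_id_l f) at 2.
    rewrite <- (convolution_precomp hf), (proj2 hs).
    apply (convolution_unit_precomp hf). }
  split.
  - rewrite <- (convolution_act_unit c second (dup _ ∘ (s ∘ f))).
    rewrite <- l, convolution_act_mul.
    rewrite <- (convolution_act_unit c first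
      (convolution_act c second f (dup _ ∘ (s ∘ f)))).
    rewrite <- l, convolution_act_mul, <- (dup_convolution _ hf), r.
    rewrite (com_dup (convolution_unit_comonoid_morphism)).
    rewrite convolution_act_first, convolution_unit_r.
    rewrite (convolution_act_second hc), convolution_unit_r; reflexivity.
  - transitivity (del (bi_com H) ∘ convolution c (bi_mon H) f (s ∘ f)).
    + unfold convolution. rw (bi_del_mul H).
      rewrite <- (comp_assoc (del _ ⊠ del _)), <- tensm_comp, (com_del hf).
      rewrite <- (tensm_split_r (del c)). rw (dup_del_l c). rw (lun_natural _).
      rewrite lun_inv_r, comp_id_r; reflexivity.
    + rewrite r; apply (com_del convolution_unit_comonoid_morphism).
Qed.
End ComonoidMorphismsIntoBimonoid.

(** * Group objects in a cartesian category *)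

Lemma comonoid_ext (E : MonoidalCategory) (K : E) (c c' : ComonoidOn K) :
  dup c = dup c' -> del c = del c' -> c = c'.
Proof.
  destruct c, c'; simpl; intros e1 e2; subst; f_equal; apply proof_irrelevance.
Qed.

Definition diagonal {C : Category} (P : FiniteProducts C) (X : C) :
    @ComonoidOn (CartesianBraided P) X.
Proof.
  refine {| dup := pair P (idm X) (idm X) : hom (c := CartesianBraided P) _ _;
            del := bang P X |};
  abstract (simpl; cartesian).
Defined.

(** The counit laws force both projections of [dup c] to be identities, and
    [del c] is a map to the terminal object. *)
Lemma comonoid_is_diagonal (C : Category) (P : FiniteProducts C) (X : C)
    (c : @ComonoidOn (CartesianBraided P) X) : c = diagonal P X.
Proof.
  apply comonoid_ext; [| apply term_ext].
  apply pair_ext; simpl; rewrite ?pr1_pair, ?pr2_pair.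
  - transitivity (pr1 P X (term P) ∘ run_inv (m := CartesianBraided P) X).
    + rewrite <- (dup_del_r c); simpl.
      rewrite pr1_pair_l, comp_id_l; reflexivity.
    + apply pr1_pair.
  - transitivity (pr2 P (term P) X ∘ lun_inv (m := CartesianBraided P) X).
    + rewrite <- (dup_del_l c); simpl.
      rewrite pr2_pair_l, comp_id_l; reflexivity.
    + apply pr2_pair.
Qed.

(** A lift of the functor [Hom(-, G)] to groups, which is how a group object is
    presented by the Yoneda lemma. *)
Record GroupOnHoms {C : Category} (G : C) := {
  gmul : forall X : C, X ~> G -> X ~> G -> X ~> G;
  gone : forall X : C, X ~> G;
  ginv : forall X : C, X ~> G -> X ~> G;
  gmul_natural : forall (X Y : C) (h : X ~> Y) (f g : Y ~> G),
    gmul f g ∘ h = gmul (f ∘ h) (g ∘ h);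
  gone_natural : forall (X Y : C) (h : X ~> Y), gone Y ∘ h = gone X;
  gmul_assoc : forall (X : C) (f g k : X ~> G),
    gmul (gmul f g) k = gmul f (gmul g k);
  gmul_one_l : forall (X : C) (f : X ~> G), gmul (gone X) f = f;
  gmul_one_r : forall (X : C) (f : X ~> G), gmul f (gone X) = f;
  gmul_inv_l : forall (X : C) (f : X ~> G), gmul (ginv f) f = gone X;
  gmul_inv_r : forall (X : C) (f : X ~> G), gmul f (ginv f) = gone X
}.

Section GroupObject.
Context {C : Category} (P : FiniteProducts C) {G : C} (S : GroupOnHoms G).

Ltac gcalc :=
  simpl; repeat rewrite ?gmul_natural, ?gone_natural, ?gmul_assoc, ?gmul_one_l,
    ?gmul_one_r, ?gmul_inv_l, ?gmul_inv_r, ?comp_assoc, ?pr1_pair, ?pr2_pair,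
    ?pr1_pair_l, ?pr2_pair_l, ?comp_id_l, ?comp_id_r.

Definition group_object_monoid : @MonoidOn (CartesianBraided P) G.
Proof.
  refine {|
    mul := gmul S (pr1 P G G) (pr2 P G G) : hom (c := CartesianBraided P) _ _;
    one := gone S (term P) |};
  abstract (gcalc; reflexivity).
Defined.

(** With the diagonal as comultiplication, the bimonoid axioms hold for every
    monoid object: all maps are compatible with diagonals. *)
Definition group_object : Bimonoid (CartesianBraided P).
Proof.
  refine (Build_Bimonoid (bi_ob := (G : CartesianBraided P))
    (bi_mon := group_object_monoid) (bi_com := diagonal P G) _ _ _ _);
  abstract (unfold interchange; simpl;
    first [apply term_ext | apply pair_ext; gcalc; reflexivity]).
Defined.

Lemma group_object_hopf : IsHopf group_object.
Proof.
  exists (ginv S (idm G)); split; unfold convolution, convolution_unit; gcalc;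
    reflexivity.
Qed.
End GroupObject.

(** * Coreflections and right adjoints *)

(** An object [corefl] such that [Hom(X, corefl)] is the set of those
    [f : L X ~> Y] that satisfy [Q].  For the constant predicate [True] the
    counit is a couniversal arrow from [L] to [Y]; for other [Q] the notion
    covers comonoid morphisms out of [L X] without a category of
    comonoids. *)
Record Coreflection {C D : Category} (L : Functor C D) (Y : D)
    (Q : forall X : C, L X ~> Y -> Prop) := {
  corefl :> C;
  counit : L corefl ~> Y;
  counit_in : forall (X : C) (h : X ~> corefl), Q X (counit ∘ fmap L h);
  factor : forall (X : C) (f : L X ~> Y), Q X f -> X ~> corefl;
  counit_factor : forall (X : C) (f : L X ~> Y) (hf : Q X f),
    counit ∘ fmap L (factor hf) = f;
  counit_inj : forall (X : C) (h k : X ~> corefl),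
    counit ∘ fmap L h = counit ∘ fmap L k -> h = k
}.
Arguments counit_in {C D L Y Q} c {X} h.
Arguments factor {C D L Y Q} c {X f} hf.
Arguments counit_factor {C D L Y Q} c {X f} hf.
Arguments counit_inj {C D L Y Q} c {X h k} _.

Lemma inhabitant (A : Type) : inhabited A -> A.
Proof.
  intros h.
  destruct (constructive_indefinite_description (fun _ : A => True)) as [a _].
  - destruct h as [a]; exists a; exact I.
  - exact a.
Qed.

Lemma right_adjoint_of_coreflections (C D : Category) (L : Functor C D) :
  (forall Y : D, inhabited (Coreflection (L := L) (Y := Y) (fun _ _ => True))) ->
  HasRightAdjoint L.
Proof.
  intros h.
  pose (G := fun Y => inhabitant (h Y)).
  pose (lift := fun (X : C) (Y : D) (f : L X ~> Y) =>
    factor (G Y) (f := f) I).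
  assert (lift_ok : forall X Y (f : L X ~> Y), counit (G Y) ∘ fmap L (lift X Y f) = f)
    by (intros; apply counit_factor).
  assert (lift_eq : forall X Y (f : L X ~> Y) (k : X ~> G Y),
      counit (G Y) ∘ fmap L k = f -> lift X Y f = k)
    by (intros; apply counit_inj; rewrite lift_ok; symmetry; assumption).
  assert (R_id : forall Y, lift (G Y) Y (idm Y ∘ counit (G Y)) = idm (corefl (G Y))).
  { intros Y; apply lift_eq. rewrite fmap_id, comp_id_l, comp_id_r; reflexivity. }
  assert (R_comp : forall X Y Z (g : Y ~> Z) (f : X ~> Y),
      lift (G X) Z (g ∘ f ∘ counit (G X)) =
      lift (G Y) Z (g ∘ counit (G Y)) ∘ lift (G X) Y (f ∘ counit (G X))).
  { intros X Y Z g f; apply lift_eq.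
    rewrite fmap_comp. rw (lift_ok _ _ _). rw (lift_ok _ _ _). reflexivity. }
  exists (Build_Functor R_id R_comp).
  constructor.
  unshelve refine (Build_Adjunction (L := L) (R := Build_Functor R_id R_comp)
    (adj_to := fun X Y f => lift X Y f)
    (adj_from := fun X Y k => counit (G Y) ∘ fmap L k) _ _ _); simpl.
  - intros; apply lift_ok.
  - intros; apply lift_eq; reflexivity.
  - intros; apply lift_eq. rewrite !fmap_comp.
    rw (lift_ok _ _ _). rw (lift_ok _ _ _). reflexivity.
Qed.

(** * Equalizers from finite limits *)

(** Arrows of the category [false ⇉ true]; the booleans are the two parallel
    arrows, and [parallel_functor f g] sends the arrow [false]
    to [f] and the arrow [true] to [g]. *)
Definition parallel_hom (i j : bool) : Set :=
  match i, j with
  | false, false | true, true => unit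
  | false, true => bool
  | true, false => Empty_set
  end.

Definition ParallelPair : Category.
Proof.
  unshelve refine {|
    ob := bool;
    hom := parallel_hom;
    idm := fun i => match i return parallel_hom i i with false | true => tt end;
    comp := fun i j k => match i, j, k
        return parallel_hom j k -> parallel_hom i j -> parallel_hom i k with
      | false, false, false | true, true, true => fun _ _ => tt
      | false, false, true => fun g _ => g
      | false, true, true => fun _ f => f
      | false, true, false => fun g _ => match g with end
      | true, false, _ => fun _ f => match f with end
      | true, true, false => fun g _ => g
      end
  |};
  abstract (intros; repeat match goal with i : bool |- _ => destruct i end;
    simpl in *; repeat match goal with
      | e : Empty_set |- _ => destruct e
      | u : unit |- _ => destruct u end; reflexivity).
Defined.

Lemma parallel_pair_finite : FiniteCategory ParallelPair.
Proof.
  split.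
  - exists (false :: true :: nil); intros []; simpl; auto.
  - intros [] [].
    + exists (tt :: nil); intros []; simpl; auto.
    + exists nil; intros [].
    + exists (false :: true :: nil); intros []; simpl; auto.
    + exists (tt :: nil); intros []; simpl; auto.
Qed.

Definition parallel_functor {C : Category} {X Y : C} (f g : X ~> Y) :
    Functor ParallelPair C.
Proof.
  unshelve refine (Build_Functor (C := ParallelPair)
    (fob := fun i : bool => if i then Y else X)
    (fmap := fun i j : bool => match i, j
        return parallel_hom i j -> (if i then Y else X) ~> (if j then Y else X) with
      | false, false => fun _ => idm X
      | false, true => fun b : bool => if b then g else f
      | true, false => fun e => match e with end
      | true, true => fun _ => idm Y
      end) _ _).
  - abstract (intros []; reflexivity).
  - abstract (intros [] [] []; simpl; intros a b; try destruct a; try destruct b;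
      rewrite ?comp_id_l, ?comp_id_r; reflexivity).
Defined.

Lemma equalizer_exists (C : Category) (hC : FinitelyComplete C) (X Y : C)
    (f g : X ~> Y) :
  exists (E : C) (i : E ~> X), f ∘ i = g ∘ i /\
    forall (W : C) (h : W ~> X), f ∘ h = g ∘ h -> exists! k : W ~> E, i ∘ k = h.
Proof.
  destruct (hC _ parallel_pair_finite (parallel_functor f g)) as [K hK].
  exists (apex K), (leg K false); split.
  - transitivity (leg K true).
    + exact (leg_natural K (i := false) (j := true) false).
    + symmetry; exact (leg_natural K (i := false) (j := true) true).
  - intros W h e.
    assert (nat : forall (i j : ParallelPair) (a : i ~> j),
      fmap (parallel_functor f g) a ∘
        (match i return W ~> parallel_functor f g i with
         | false => h | true => f ∘ h end) =
        (match j return W ~> parallel_functor f g j with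
         | false => h | true => f ∘ h end)).
    { intros [] [] a; simpl in *; try destruct a; rewrite ?comp_id_l; auto. }
    destruct (hK (Build_Cone nat)) as [k [hk uniq]]; simpl in *.
    exists k; split.
    + exact (hk false).
    + intros k' hk'; apply uniq; intros []; [| exact hk'].
      rewrite <- (leg_natural K (i := false) (j := true) false); simpl.
      rewrite comp_assoc, hk'; reflexivity.
Qed.

(** * Cofree comonoids *)

Lemma diagonal_natural (C : Category) (P : FiniteProducts C)
    (X Y : CartesianBraided P) (h : X ~> Y) :
  IsComonoidMorphism (diagonal P X) (diagonal P Y) h.
Proof. split; simpl; cartesian. Qed.

Lemma diagonal_cocommutative (C : Category) (P : FiniteProducts C)
    (X : CartesianBraided P) :
  Cocommutative (E := CartesianBraided P) (diagonal P X).
Proof. unfold Cocommutative; simpl; cartesian. Qed.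

Lemma induced_cocommutative (C D : BraidedCategory) (L : Functor C D)
    (p : LaxStructure L) (q : ColaxStructure L) (hL : IsBistrong p q)
    (hbraided : IsBraided p) (K : C) (c : ComonoidOn K) :
  Cocommutative c -> Cocommutative (induced_comonoid q c).
Proof.
  unfold Cocommutative; cbn [dup induced_comonoid]; intros hc.
  apply (iso_mono (bistrong_lax2 hL K K)).
  rw (hbraided K K). rewrite <- !(comp_assoc (lax2 p K K)), (lax2_colax2 hL).
  rewrite !comp_id_l, <- fmap_comp, hc; reflexivity.
Qed.

Lemma induced_comonoid_morphism (C D : MonoidalCategory) (L : Functor C D)
    (q : ColaxStructure L) (K K' : C) (c : ComonoidOn K) (c' : ComonoidOn K')
    (h : K ~> K') :
  IsComonoidMorphism c c' h ->
  IsComonoidMorphism (induced_comonoid q c) (induced_comonoid q c') (fmap L h).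
Proof.
  intros [h1 h2]; split; cbn [dup del induced_comonoid]; rewrite comp_assoc, <- fmap_comp.
  - rewrite h1, fmap_comp. rw (colax2_natural q _ _). reflexivity.
  - rewrite h2; reflexivity.
Qed.

Lemma adj_to_precomp (C D : Category) (L : Functor C D) (R : Functor D C)
    (adj : Adjunction L R) (X X' : C) (Y : D) (h : X' ~> X) (f : L X ~> Y) :
  adj_to adj (f ∘ fmap L h) = adj_to adj f ∘ h.
Proof.
  rewrite <- (comp_id_l f) at 1.
  rewrite (adj_natural adj), fmap_id, comp_id_l; reflexivity.
Qed.

Lemma adj_to_postcomp (C D : Category) (L : Functor C D) (R : Functor D C)
    (adj : Adjunction L R) (X : C) (Y Y' : D) (f : L X ~> Y) (k : Y ~> Y') :
  adj_to adj (k ∘ f) = fmap R k ∘ adj_to adj f.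
Proof.
  rewrite <- (comp_id_r (k ∘ f)), <- (fmap_id L X).
  rewrite (adj_natural adj), comp_id_r; reflexivity.
Qed.

Lemma adj_to_inj (C D : Category) (L : Functor C D) (R : Functor D C)
    (adj : Adjunction L R) (X : C) (Y : D) (f g : L X ~> Y) :
  adj_to adj f = adj_to adj g -> f = g.
Proof.
  intros e; rewrite <- (adj_from_to adj f), e; apply adj_from_to.
Qed.

Lemma pair_comp (C : Category) (P : FiniteProducts C) (W X Y Z : C)
    (f : X ~> Y) (g : X ~> Z) (h : W ~> X) :
  pair P f g ∘ h = pair P (f ∘ h) (g ∘ h).
Proof. cartesian. Qed.

Lemma pair_eq_iff (C : Category) (P : FiniteProducts C) (X Y Z : C)
    (f f' : X ~> Y) (g g' : X ~> Z) :
  pair P f g = pair P f' g' <-> f = f' /\ g = g'.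
Proof.
  split.
  - intros e; split.
    + rewrite <- (pr1_pair P f g), e; apply pr1_pair.
    + rewrite <- (pr2_pair P f g), e; apply pr2_pair.
  - intros [e1 e2]; rewrite e1, e2; reflexivity.
Qed.

(** Both conditions on a comonoid morphism [L X ~> K] transpose to equations
    between composites of its transpose [X ~> R K] with fixed maps out of
    [R K], so an equalizer represents them together. *)
Lemma cofree_comonoid (C : Category) (hC : FinitelyComplete C)
    (P : FiniteProducts C) (D : MonoidalCategory)
    (L : Functor (CartesianBraided P) D) (R : Functor D (CartesianBraided P))
    (adj : Adjunction L R) (q : ColaxStructure L) (K : D) (k : ComonoidOn K) :
  inhabited (Coreflection (L := L) (Y := K) (fun X f =>
    IsComonoidMorphism (induced_comonoid q (diagonal P X)) k f)).
Proof.
  pose (cX := fun X : CartesianBraided P => induced_comonoid q (diagonal P X)).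
  (* By naturality, a general [f] reduces to the case of the counit [e] of the
     adjunction: [d] and [t] transpose the right-hand sides of the two comonoid
     morphism equations for [e]. *)
  pose (e := adj_from adj (idm (R K))).
  pose (d := adj_to adj ((e ⊠ e) ∘ dup (cX (R K)))).
  pose (t := adj_to adj (del (cX (R K)))).
  assert (comonoid_iff : forall (X : CartesianBraided P) (f : L X ~> K),
      IsComonoidMorphism (cX X) k f <->
      fmap R (dup k) ∘ adj_to adj f = d ∘ adj_to adj f /\
      fmap R (del k) ∘ adj_to adj f = t ∘ adj_to adj f).
  { intros X f.
    pose proof (induced_comonoid_morphism q (diagonal_natural (P := P) (adj_to adj f)))
      as [h1 h2].
    assert (ef : e ∘ fmap L (adj_to adj f) = f).
    { apply (adj_to_inj (adj := adj)). rewrite adj_to_precomp.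
      unfold e; rewrite adj_to_from; apply comp_id_l. }
    unfold d, t; rewrite <- !adj_to_precomp, <- !adj_to_postcomp.
    rewrite comp_assoc; unfold cX; rewrite h1, h2, <- comp_assoc, <- tensm_comp, ef.
    split.
    - intros [f1 f2]; split; f_equal; assumption.
    - intros [f1 f2]; split; apply (adj_to_inj (adj := adj)); assumption. }
  destruct (equalizer_exists hC (pair P (fmap R (dup k)) (fmap R (del k)))
    (pair P d t)) as [E [i [hi univ]]].
  assert (equalized_iff : forall (X : CartesianBraided P) (h : X ~> R K),
      pair P (fmap R (dup k)) (fmap R (del k)) ∘ h = pair P d t ∘ h <->
      fmap R (dup k) ∘ h = d ∘ h /\ fmap R (del k) ∘ h = t ∘ h).
  { intros X h; rewrite !pair_comp; apply pair_eq_iff. }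
  assert (mediate : forall (X : CartesianBraided P) (f : L X ~> K),
      IsComonoidMorphism (cX X) k f -> {h : X ~> E | i ∘ h = adj_to adj f}).
  { intros X f hf; apply constructive_indefinite_description.
    destruct (univ X (adj_to adj f)) as [h [hh _]].
    - apply equalized_iff, comonoid_iff, hf.
    - exists h; exact hh. }
  constructor.
  refine (Build_Coreflection (L := L) (Y := K) (corefl := E)
    (Q := fun X f => IsComonoidMorphism (cX X) k f)
    (counit := adj_from adj i)
    (factor := fun X f hf => proj1_sig (mediate X f hf)) _ _ _).
  - intros X h. apply comonoid_iff, equalized_iff.
    rewrite adj_to_precomp, adj_to_from, <- !comp_assoc; apply comp_r; exact hi.
  - intros X f hf; apply (adj_to_inj (adj := adj)).
    rewrite adj_to_precomp, adj_to_from. exact (proj2_sig (mediate X f hf)).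
  - intros X h h' eq.
    apply (f_equal (fun u => adj_to adj u)) in eq.
    rewrite !adj_to_precomp, adj_to_from in eq.
    destruct (univ X (i ∘ h)) as [u [_ uniq]].
    + rewrite <- !comp_assoc; apply comp_r; exact hi.
    + rewrite <- (uniq h eq_refl); apply uniq; symmetry; exact eq.
Qed.

(** * The group object of comonoid morphisms into a Hopf monoid *)

Section Transfer.
Context {C : Category} {P : FiniteProducts C} {D : BraidedCategory}
  {L : Functor (CartesianBraided P) D} {p : LaxStructure L} {q : ColaxStructure L}
  (hL : IsBistrong p q) (hbraided : IsBraided p).

Notation image X := (induced_comonoid q (diagonal P X)).

Lemma image_cocommutative (X : CartesianBraided P) : Cocommutative (image X).
Proof.
  exact (induced_cocommutative hL hbraided (diagonal_cocommutative (P := P) X)).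
Qed.

Lemma image_morphism (X Y : CartesianBraided P) (h : X ~> Y) :
  IsComonoidMorphism (image X) (image Y) (fmap L h).
Proof. exact (induced_comonoid_morphism q (diagonal_natural (P := P) h)). Qed.

(** Applied to [pr1] and [pr2], the pairing along the diagonal is the identity
    of the product; under [L] it becomes [colax2].  Hence convolving two maps
    pulled back along the projections is the same as multiplying after
    [colax2]. *)
Lemma image_pairing (X Y : CartesianBraided P) (A B : D) (f : L X ~> A) (g : L Y ~> B) :
  ((f ∘ fmap L (pr1 P X Y)) ⊠ (g ∘ fmap L (pr2 P X Y))) ∘ dup (image (prd P X Y)) =
  (f ⊠ g) ∘ colax2 q X Y.
Proof.
  cbn [dup induced_comonoid]. rewrite tensm_comp.
  rwr (colax2_natural q _ _). rewrite <- fmap_comp.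
  match goal with |- context [fmap L ?u] =>
    replace u with (idm (tens (m := CartesianBraided P) X Y)) end.
  - rewrite fmap_id, comp_id_r; reflexivity.
  - simpl; cartesian.
Qed.

Lemma colax2_lax2 (X Y : CartesianBraided P) : colax2 q X Y ∘ lax2 p X Y = idm _.
Proof.
  apply (iso_mono (bistrong_lax2 hL X Y)).
  rw (lax2_colax2 hL X Y). rewrite comp_id_l, comp_id_r; reflexivity.
Qed.

Section Points.
Context {H : Bimonoid D} (s : H ~> H)
  (hs : ConvolutionInverse (bi_com H) (bi_mon H) (idm H) s)
  (G : Coreflection (L := L) (Y := H)
     (fun X f => IsComonoidMorphism (image X) (bi_com H) f)).

Let ε : L G ~> H := counit G.

Lemma counit_image (X : CartesianBraided P) (h : X ~> G) :
  IsComonoidMorphism (image X) (bi_com H) (ε ∘ fmap L h).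
Proof. exact (counit_in G h). Qed.

Definition point_mul (X : CartesianBraided P) (f g : X ~> G) : X ~> G :=
  factor G (convolution_comonoid_morphism (image_cocommutative X)
    (counit_image f) (counit_image g)).

Definition point_one (X : CartesianBraided P) : X ~> G :=
  factor G (convolution_unit_comonoid_morphism (c := image X) (H := H)).

Definition point_inv (X : CartesianBraided P) (f : X ~> G) : X ~> G :=
  factor G (antipode_comonoid_morphism (image_cocommutative X) hs (counit_image f)).

Lemma counit_point_mul (X : CartesianBraided P) (f g : X ~> G) :
  ε ∘ fmap L (point_mul f g) =
  convolution (image X) (bi_mon H) (ε ∘ fmap L f) (ε ∘ fmap L g).
Proof. apply counit_factor. Qed.

Lemma counit_point_one (X : CartesianBraided P) :
  ε ∘ fmap L (point_one X) = convolution_unit (image X) (bi_mon H).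
Proof. apply counit_factor. Qed.

Lemma counit_point_inv (X : CartesianBraided P) (f : X ~> G) :
  ε ∘ fmap L (point_inv f) = s ∘ (ε ∘ fmap L f).
Proof. apply counit_factor. Qed.

(** The group laws are those of convolution, read back along the counit; the
    antipode axiom supplies the inverses. *)
Definition points : GroupOnHoms (C := CartesianBraided P) G.
Proof.
  refine {| gmul := point_mul; gone := point_one; ginv := point_inv |};
    intros; apply counit_inj; fold ε.
  - rewrite fmap_comp, <- comp_assoc, !counit_point_mul, !fmap_comp, <- !comp_assoc.
    apply (convolution_precomp (image_morphism h)).
  - rewrite fmap_comp, <- comp_assoc, !counit_point_one.
    apply (convolution_unit_precomp (image_morphism h)).
  - rewrite !counit_point_mul.
    exact (convolution_act_mul (image X) (regular_module (bi_mon H)) _ _ _).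
  - rewrite counit_point_mul, counit_point_one.
    exact (convolution_act_unit (image X) (regular_module (bi_mon H)) _).
  - rewrite counit_point_mul, counit_point_one. apply convolution_unit_r.
  - rewrite counit_point_mul, counit_point_one, counit_point_inv.
    rewrite <- (comp_id_l (ε ∘ fmap L f)) at 2.
    rewrite <- (convolution_precomp (counit_image f)), (proj2 hs).
    apply (convolution_unit_precomp (counit_image f)).
  - rewrite counit_point_mul, counit_point_one, counit_point_inv.
    rewrite <- (comp_id_l (ε ∘ fmap L f)) at 1.
    rewrite <- (convolution_precomp (counit_image f)), (proj1 hs).
    apply (convolution_unit_precomp (counit_image f)).
Defined.

Definition points_bimonoid : Bimonoid (CartesianBraided P) := group_object P points.

Lemma counit_mul (X Y : CartesianBraided P) (f : X ~> G) (g : Y ~> G) :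
  ε ∘ fmap L (mul (bi_mon points_bimonoid) ∘ (f ⊠ g)) =
  mul (bi_mon H) ∘ ((ε ∘ fmap L f) ⊠ (ε ∘ fmap L g)) ∘ colax2 q X Y.
Proof.
  transitivity (ε ∘ fmap L (point_mul (X := prd P X Y)
    (f ∘ pr1 P X Y : hom (c := CartesianBraided P) _ _) (g ∘ pr2 P X Y))).
  - apply comp_l, f_equal; simpl.
    rewrite (gmul_natural points), pr1_pair, pr2_pair; reflexivity.
  - rewrite counit_point_mul; unfold convolution.
    rewrite comp_assoc, !fmap_comp, <- !(comp_assoc ε), image_pairing, comp_assoc.
    reflexivity.
Qed.

Lemma counit_one :
  ε ∘ fmap L (one (bi_mon points_bimonoid)) = one (bi_mon H) ∘ colax0 q.
Proof.
  rewrite counit_point_one. unfold convolution_unit; cbn [del induced_comonoid diagonal].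
  apply comp_l. transitivity (colax0 q ∘ fmap L (idm (munit (m := CartesianBraided P)))).
  - apply comp_l, f_equal, (term_ext (P := P)).
  - rewrite fmap_id; apply comp_id_r.
Qed.

(** Compatibility with the comonoid structures is automatic on the left, by
    naturality of the diagonal, and on the right, by the property that defines
    [G].  Compatibility with multiplication and unit is transported by
    [counit_mul] and [counit_one], because [lax2] and [lax0] are inverse to
    [colax2] and [colax0]. *)
Lemma points_morphism_iff (B : Bimonoid (CartesianBraided P)) (h : B ~> G) :
  IsBimonoidMorphism (A := B) (B := points_bimonoid) h <->
  IsBimonoidMorphism (A := induced_bimonoid hL B) (B := H) (ε ∘ fmap L h).
Proof.
  split; intros [h1 h2 h3 h4].
  - pose proof (counit_image h) as [d e].
    rewrite <- (comonoid_is_diagonal (P := P) (bi_com B)) in d, e.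
    split; cbn [induced_bimonoid bi_mon bi_com bi_ob].
    + cbn [mul induced_monoid]. rwr (fmap_comp L h _).
      replace (h ∘ mul (bi_mon B)) with (mul (bi_mon points_bimonoid) ∘ (h ⊠ h))
        by (symmetry; exact h1).
      rewrite <- comp_assoc, counit_mul. rw (colax2_lax2 _ _).
      rewrite comp_id_r; reflexivity.
    + cbn [one induced_monoid]. rwr (fmap_comp L h _).
      replace (h ∘ one (bi_mon B)) with (one (bi_mon points_bimonoid))
        by (symmetry; exact h2).
      transitivity (one (bi_mon H) ∘ colax0 q ∘ lax0 p).
      * rewrite <- comp_assoc; exact (comp_r _ counit_one).
      * rw (bilax_unit hL). apply comp_id_r.
    + exact d.
    + exact e.
  - cbn [induced_bimonoid bi_mon bi_com bi_ob induced_monoid mul one] in h1, h2.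
    split.
    + apply (counit_inj G); fold ε.
      transitivity (mul (bi_mon H) ∘ ((ε ∘ fmap L h) ⊠ (ε ∘ fmap L h)) ∘ colax2 q B B);
        [| symmetry; exact (counit_mul h h)].
      apply (iso_epi (bistrong_lax2 hL B B)).
      rw (colax2_lax2 B B). rewrite comp_id_r, fmap_comp, <- !comp_assoc.
      rewrite <- comp_assoc in h1; exact h1.
    + apply (counit_inj G); fold ε.
      transitivity (one (bi_mon H) ∘ colax0 q); [| symmetry; exact counit_one].
      apply (iso_epi (bistrong_lax0 hL)).
      rw (bilax_unit hL). rewrite comp_id_r, fmap_comp, <- !comp_assoc.
      rewrite <- comp_assoc in h2; exact h2.
    + rewrite (comonoid_is_diagonal (P := P) (bi_com B)).
      exact (com_dup (diagonal_natural (P := P) h)).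
    + rewrite (comonoid_is_diagonal (P := P) (bi_com B)).
      exact (com_del (diagonal_natural (P := P) h)).
Qed.

End Points.

(** A bimonoid morphism [L X ~> H] factors through the counit already as a
    comonoid morphism, and [points_morphism_iff] makes its factor a
    homomorphism; so the cofree comonoid on [H] is also couniversal among Hopf
    monoids. *)
Lemma hopf_coreflection (Y : Hopf D) :
  inhabited (Coreflection (L := L) (Y := proj1_sig Y : Bimonoid D) (fun X f =>
    IsComonoidMorphism (image X) (bi_com (proj1_sig Y)) f)) ->
  inhabited (Coreflection (L := HopfFunctor hL) (Y := Y) (fun _ _ => True)).
Proof.
  destruct Y as [H [s hs]]; cbn [proj1_sig]; intros [G].
  pose (GB := exist _ _ (group_object_hopf P (points hs G))
    : Hopf (CartesianBraided P)).
  pose (morphism_iff := points_morphism_iff hs (G := G)).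
  assert (com : forall (X : Bimonoid (CartesianBraided P)) (f : L X ~> H),
    IsBimonoidMorphism (A := induced_bimonoid hL X) (B := H) f ->
    IsComonoidMorphism (induced_comonoid q (diagonal P X)) (bi_com H) f).
  { intros X f [_ _ f3 f4]; split.
    - rewrite <- (comonoid_is_diagonal (P := P) (bi_com X)); exact f3.
    - rewrite <- (comonoid_is_diagonal (P := P) (bi_com X)); exact f4. }
  assert (lift : forall (X : Bimonoid (CartesianBraided P)) (f : L X ~> H)
    (hf : IsBimonoidMorphism (A := induced_bimonoid hL X) (B := H) f),
    IsBimonoidMorphism (A := X) (B := points_bimonoid hs G)
      (factor G (com X f hf))).
  { intros X f hf; apply morphism_iff. rewrite (counit_factor G (com X f hf)). exact hf. }
  assert (counit_morphism : IsBimonoidMorphism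
    (A := induced_bimonoid hL (points_bimonoid hs G)) (B := H) (counit G)).
  { assert (e : counit G = counit G ∘ fmap L (idm (corefl G)))
      by (rewrite fmap_id, comp_id_r; reflexivity).
    rewrite e; apply morphism_iff; exact (bimonoid_morphism_id (points_bimonoid hs G)). }
  pose (HD := exist _ H (ex_intro _ s hs) : Hopf D).
  pose (ε := exist _ (counit G) counit_morphism : HopfFunctor hL GB ~> HD).
  pose (bi_factor := fun (X : Hopf (CartesianBraided P)) (f : HopfFunctor hL X ~> HD) =>
    exist _ _ (lift _ _ (proj2_sig f)) : X ~> GB).
  constructor.
  refine (Build_Coreflection (L := HopfFunctor hL) (corefl := GB) (counit := ε)
    (fun _ _ => I) (factor := fun X f _ => bi_factor X f) _ _).
  - intros X f hf; apply sig_ext; exact (counit_factor G (com _ _ (proj2_sig f))).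
  - intros X h k e; apply sig_ext; apply (counit_inj G).
    exact (f_equal (@proj1_sig _ _) e).
Qed.

End Transfer.

Theorem proposition7p1
  (C : Category) (hC : FinitelyComplete C) (P : FiniteProducts C)
  (D : BraidedCategory)
  (L : Functor C D) (R : Functor D C) (adj : Adjunction L R)
  (p : @LaxStructure (CartesianBraided P) D L)
  (q : @ColaxStructure (CartesianBraided P) D L)
  (hL : @IsBistrong (CartesianBraided P) D L p q)
  (hbraided : @IsBraided (CartesianBraided P) D L p) :
  HasRightAdjoint (HopfFunctor hL : Functor (Hopf (CartesianBraided P)) (Hopf D)).
Proof.
  apply right_adjoint_of_coreflections; intros Y.
  apply (hopf_coreflection hL hbraided).
  exact (cofree_comonoid hC (P := P) adj q (bi_com (proj1_sig Y))).
Qed.
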